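(* Let $\mathcal{A}$ be a locally finite hyperplane arrangement in $\mathbb{R}^n$, and let $\dashv$ be a valid order of the set of chambers $\mathcal{C}(\mathcal{A})$. For every chamber $C \in \mathcal{C}(\mathcal{A})$, there exists a proper acyclic matching on $N(C)$ such that the only critical cell is $\langle C, F_C\rangle$. The union of these matchings forms a proper acyclic matching on $\mathrm{Sal}(\mathcal{A})$ with critical cells in bijection with the chambers.
   Context: Arrangements. $\mathcal{A}$ is a locally finite set of affine hyperplanes in $\mathbb{R}^n$. It stratifies $\mathbb{R}^n$; the faces are the closures of the strata (where two points are in the same stratum iff, for each $H\in\mathcal{A}$, both lie on $H$ or both lie strictly on the same side of $H$). $\mathcal{F}=\mathcal{F}(\mathcal{A})$ is the set of faces, ordered by $F \preceq G \iff F \supseteq G$ and ranked by codimension; chambers are the faces of codimension $0$, and $\mathcal{C}=\mathcal{C}(\mathcal{A})$ is the set of chambers. For $C,C'\in\mathcal{C}$, $s(C,C')\subseteq\mathcal{A}$ is the set of hyperplanes separating $C$ and $C'$. $\mathcal{L}$ is the poset of flats ((nonempty) intersections of hyperplanes of $\mathcal{A}$, including $\mathbb{R}^n$), ordered by reverse inclusion. For $U\subseteq\mathbb{R}^n$, $\mathrm{supp}(U)=\{H\in\mathcal{A}\mid U\subseteq H\}$ and $|U|$ is the affine span of $U$. For a chamber $C$ and a face $F$, $C.F$ is the unique chamber $C'$ with $F\subseteq C'$ and $\mathrm{supp}(F)\cap s(C,C')=\emptyset$. Salvetti complex. $\mathrm{Sal}(\mathcal{A})$ is the poset of cells of the Salvetti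 complex: there is a $k$-cell $\langle C,F\rangle$ for each chamber $C$ and each face $F$ of $C$ of codimension $k$, and $\langle C,F\rangle$ is in the boundary of $\langle D,G\rangle$ (i.e. $\langle C,F\rangle<\langle D,G\rangle$) iff $F\prec G$ and $D.F=C$. Decomposition. For a chamber $C$, $S(C)=\{\langle C',F\rangle\in\mathrm{Sal}(\mathcal{A})\mid C'=C.F\}$. Given a total order $\dashv$ on $\mathcal{C}$ (of order type that of the natural numbers when $\mathcal{C}$ is infinite), $N(C)\subseteq S(C)$ is the set of cells of $S(C)$ not contained in any $S(C')$ with $C'\dashv C$. Valid orders. Let $\mathcal{J}(C)=\{X\in\mathcal{L}\mid \mathrm{supp}(X)\cap s(C,C')\neq\emptyset \text{ for all } C'\dashv C\}$. The order $\dashv$ is valid if for every chamber $C$ the set $\mathcal{J}(C)$ is a principal upper ideal of $\mathcal{L}$ generated by some flat $X_C=|F_C|$, where $F_C$ is a face of $C$. Matchings. For a ranked poset $P$, let $\mathcal{E}=\{(p,q)\mid q\lessdot p\}$ be the set of edges of its Hasse diagram. A matching is a subset $\mathcal{M}\subseteq\mathcal{E}$ such that every element of $P$ appears in at most one edge of $\mathcal{M}$; it is acyclic if the directed graph obtained by orienting $(p,q)\in\mathcal{E}$ from $p$ to $q$ when $(p,q)\notin\mathcal{M}$ and from $q$ to $p$ when $(p,q)\in\mathcal{M}$ has no directed cycle. Elements not appearing in any edge of $\mathcal{M}$ are critical. A poset map $\varphi\colon P\to Q$ is a compact grading if $\varphi^{-1}(Q_{\leq q})$ is finite for all $q\in Q$;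 an acyclic matching $\mathcal{M}$ is proper if there is a compact grading $\varphi$ with $\varphi(p)=\varphi(p')$ for all $(p,p')\in\mathcal{M}$. *)

(* Defs.v *)
From HB Require Import structures.
From Stdlib Require Import Relation_Operators.
From mathcomp Require Import all_boot all_order all_algebra.
From mathcomp Require Import all_classical all_reals all_analysis.
Set Implicit Arguments.
Unset Strict Implicit.
Unset Printing Implicit Defensive.
Import Order.TTheory GRing.Theory Num.Theory.
Import numFieldNormedType.Exports.
Local Open Scope classical_set_scope.
Local Open Scope ring_scope.

Section Arrangement.
Variables (R : realType) (n : nat).
Local Notation V := 'rV[R]_n.
Implicit Types (a : 'cV[R]_n) (b : R) (x y : V) (H U C D F G X : set V).
Implicit Types A : set (set V).

Definition affine_form a b x : R := (x *m a) 0 0 - b.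

Definition hyperplane a b : set V := [set x | affine_form a b x = 0].

Definition is_hyperplane H : Prop :=
  exists a b, a != 0 /\ H = hyperplane a b.

Definition locally_finite A : Prop :=
  forall x, exists2 U, nbhs x U & finite_set [set H | A H /\ H `&` U !=set0].

Definition arrangement A : Prop :=
  (forall H, A H -> is_hyperplane H) /\ locally_finite A.

Definition strictly_same_side H x y : Prop :=
  exists a b, [/\ a != 0, H = hyperplane a b &
                  0 < affine_form a b x * affine_form a b y].

Definition same_stratum A x y : Prop :=
  forall H, A H -> (H x /\ H y) \/ strictly_same_side H x y.

Definition stratum A x : set V := [set y | same_stratum A x y].

Definition face A F : Prop := exists x, F = closure (stratum A x).

Definition face_prec F G : Prop := G `<` F.

Definition affine_subspace (x : V) (W : {vspace V}) : set V :=
  [set y | y - x \in W].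

(* If [U] is empty this is the intersection of all affine subspaces; faces and
   flats are never empty. *)
Definition affine_span U : set V :=
  \bigcap_(Y in [set Y | (exists x W, Y = affine_subspace x W) /\ U `<=` Y]) Y.

Definition has_codim U (k : nat) : Prop :=
  exists x (W : {vspace V}),
    affine_span U = affine_subspace x W /\ (\dim W + k = n)%N.

Definition chamber A C : Prop := face A C /\ has_codim C 0.

Definition face_of A C F : Prop := face A F /\ F `<=` C.

(* Chambers are closed sets with nonempty interior, so lying in opposite closed
   half-spaces means that the interiors lie strictly on opposite sides. *)
Definition separates H C D : Prop :=
  exists a b, [/\ a != 0, H = hyperplane a b,
    (forall x, C x -> affine_form a b x <= 0) &
    (forall y, D y -> 0 <= affine_form a b y)].

Definition sep A C D : set (set V) := [set H | A H /\ separates H C D].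

Definition supp A U : set (set V) := [set H | A H /\ U `<=` H].

(* C.F ; it is meaningful when such a chamber exists and is unique, which is
   the case for every chamber [C] and every face [F] of an arrangement. *)
Definition chamber_dot A C F : set V :=
  get [set D | [/\ chamber A D, F `<=` D & supp A F `&` sep A C D = set0]].

(* The empty subfamily gives the whole space. *)
Definition flat A X : Prop :=
  (exists2 B, B `<=` A & X = \bigcap_(H in B) H) /\ X !=set0.

(* A pair (C, F) stands for the cell <C, F>. *)
Definition cell : Type := (set V * set V)%type.

Definition Sal A : set cell :=
  [set c | chamber A c.1 /\ face_of A c.1 c.2].

Definition sal_lt A (c d : cell) : Prop :=
  face_prec c.2 d.2 /\ chamber_dot A d.1 c.2 = c.1.

Definition S_cells A C : set cell :=
  [set c | Sal A c /\ c.1 = chamber_dot A C c.2].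

Definition strict_total_order_on (E : set (set V))
    (prec : set V -> set V -> Prop) : Prop :=
  [/\ forall C, E C -> ~ prec C C,
      forall C D G, E C -> E D -> E G -> prec C D -> prec D G -> prec C G &
      forall C D, E C -> E D -> C <> D -> prec C D \/ prec D C].

(* [prec D C] is the strict relation "D comes before C". *)
Definition chamber_order A (prec : set V -> set V -> Prop) : Prop :=
  strict_total_order_on (chamber A) prec /\
  (infinite_set (chamber A) ->
   exists e : nat -> set V, set_bij [set: nat] (chamber A) e /\
     forall i j, prec (e i) (e j) <-> (i < j)%N).

Definition N_cells A (prec : set V -> set V -> Prop) C : set cell :=
  [set c | S_cells A C c /\
           forall D, chamber A D -> prec D C -> ~ S_cells A D c].

Definition J_ideal A (prec : set V -> set V -> Prop) C : set (set V) :=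
  [set X | flat A X /\
    forall D, chamber A D -> prec D C -> supp A X `&` sep A C D !=set0].

(* Flats are ordered by reverse inclusion, so the principal upper ideal
   generated by X consists of the flats contained in X. *)
Definition upper_ideal A X : set (set V) := [set Y | flat A Y /\ Y `<=` X].

(* [F] is a possible choice for the face F_C. *)
Definition generating_face A (prec : set V -> set V -> Prop) C F : Prop :=
  [/\ face_of A C F, flat A (affine_span F) &
      J_ideal A prec C = upper_ideal A (affine_span F)].

Definition valid_order A (prec : set V -> set V -> Prop) : Prop :=
  chamber_order A prec /\
  forall C, chamber A C -> exists F, generating_face A prec C F.

End Arrangement.

(* The poset is the subset [P] of [T] with the strict order induced by [lt]. *)
Section Matching.
Variables (T : Type) (P : set T) (lt : T -> T -> Prop).
Implicit Types (p q : T) (M : set (T * T)).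

Definition hasse_edge : set (T * T) :=
  [set e | [/\ P e.1, P e.2, lt e.2 e.1 &
               ~ exists r, [/\ P r, lt e.2 r & lt r e.1]]].

Definition in_edge p (e : T * T) : Prop := e.1 = p \/ e.2 = p.

Definition is_matching M : Prop :=
  M `<=` hasse_edge /\
  forall p e f, M e -> M f -> in_edge p e -> in_edge p f -> e = f.

Definition oriented M p q : Prop :=
  (hasse_edge (p, q) /\ ~ M (p, q)) \/ (hasse_edge (q, p) /\ M (q, p)).

Definition acyclic M : Prop := forall p, ~ clos_trans T (oriented M) p p.

Definition critical M : set T :=
  [set p | P p /\ forall e, M e -> ~ in_edge p e].

Definition compact_grading d (Q : porderType d) (phi : T -> Q) : Prop :=
  (forall p q, P p -> P q -> lt p q -> (phi p <= phi q)%O) /\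
  (forall x : Q, finite_set [set p | P p /\ (phi p <= x)%O]).

Definition proper_acyclic_matching M : Prop :=
  [/\ is_matching M, acyclic M &
      exists d (Q : porderType d) (phi : T -> Q),
        compact_grading phi /\ forall e, M e -> phi e.1 = phi e.2].

End Matching.

(* Main.v *)
Require Import Defs.
From HB Require Import structures.
From Stdlib Require Import Relation_Operators.
From mathcomp Require Import all_boot all_order all_algebra.
From mathcomp Require Import finmap ring lra.
From mathcomp Require Import all_classical all_reals all_analysis.
Import Order.TTheory GRing.Theory Num.Theory.
Import numFieldNormedType.Exports.
Local Open Scope classical_set_scope.
Local Open Scope ring_scope.

Set Implicit Arguments.
Unset Strict Implicit.
Unset Printing Implicit Defensive.

(* Validity identifies N(C) with the faces F such that supp F_C <= supp F,
   ordered by reverse inclusion, through F |-> <C.F, F>.  Fix a point e in the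
   relative interior of F_C and grade such a face F by the finite set W of the
   hyperplanes, not containing e, of which F does not lie strictly on the side
   of e.  The fibre W = {} is the critical cell.  A nonempty fibre consists of
   the sign patterns in {0, +} taken by finitely many affine functions f_i on a
   relatively open convex set K, where all f_i are negative at e; it has an
   acyclic perfect matching by induction on the number of functions: walk from
   a generic point where all f_i are positive towards e, let f_m be the last
   function to vanish, and treat K /\ {f_m > 0} and K /\ {f_m = 0} separately,
   taking as new base points the crossing point and a point just before it.

   For the union, the cell <C.F, F> lies in N(D) for the first D with
   D.F = C.F, and D is monotone on Sal(A); a compact grading sends a cell to
   the finite set of cells reachable from it by going down in Sal(A) and by
   going up or down along matched edges. *)

(** * Sign patterns of affine functions *)

Section SmallParameters.
Variable R : realFieldType.
Implicit Types (Q : R -> Prop) (c d t : R).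

(** The interval is symmetric, so a small step can be taken in either direction along a line. *)
Definition small Q : Prop := exists2 e, 0 < e & forall t, `|t| <= e -> Q t.

Lemma small_and Q1 Q2 : small Q1 -> small Q2 -> small (fun t => Q1 t /\ Q2 t).
Proof.
move=> [e1 e1p h1] [e2 e2p h2]; exists (Num.min e1 e2).
  by rewrite lt_min e1p e2p.
by move=> t; rewrite le_min => /andP[t1 t2]; split; [exact: h1|exact: h2].
Qed.

Lemma small_sub Q1 Q2 : (forall t, Q1 t -> Q2 t) -> small Q1 -> small Q2.
Proof. by move=> h [e ep h1]; exists e => // t te; exact/h/h1. Qed.

Lemma small_all (I : eqType) (W : seq I) (Q : I -> R -> Prop) :
  (forall i, i \in W -> small (Q i)) ->
  small (fun t => forall i, i \in W -> Q i t).
Proof.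
elim: W => [|i W IH] h; first by exists 1.
have h1 := h i (mem_head _ _).
have h2 : small (fun t => forall j, j \in W -> Q j t).
  by apply: IH => j jW; apply: h; rewrite inE jW orbT.
apply: small_sub (small_and h1 h2) => t [q1 q2] j.
by rewrite inE => /orP[/eqP->//|/q2].
Qed.

Lemma small_gt0 c d : 0 < c -> small (fun t => 0 < c + t * d).
Proof.
move=> cp; have dp : 0 < `|d| + 1 by rewrite ltr_wpDl.
exists (c / 2 / (`|d| + 1)); first by rewrite !divr_gt0.
move=> t; rewrite ler_pdivlMr// => tb.
have : `|t * d| <= c / 2.
  apply: le_trans tb; rewrite normrM ler_wpM2l//; lra.
rewrite ler_norml => /andP[]; lra.
Qed.

Lemma small_lt0 c d : c < 0 -> small (fun t => c + t * d < 0).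
Proof.
move=> cn; have := @small_gt0 (- c) (- d); rewrite oppr_gt0 => /(_ cn).
by apply: small_sub => t; rewrite mulrN -opprD oppr_gt0.
Qed.

Lemma small_le b : 0 < b -> small (fun t => `|t| <= b).
Proof. by move=> bp; exists b. Qed.

Lemma small_pos Q : small Q -> exists2 t, 0 < t & Q t /\ Q (- t).
Proof.
by move=> [e ep h]; exists e => //; split; apply: h; rewrite ?normrN gtr0_norm.
Qed.

End SmallParameters.

(** * Pairing the sign patterns seen from a point *)

Section VisibleSigns.
Variables (R : realFieldType) (V : lmodType R) (I : eqType).
Implicit Types (f g : I -> V -> R) (K O : set V) (W : seq I) (x y z : V).

Definition toward x y (t : R) : V := x + t *: (y - x).

Definition affine (f : V -> R) : Prop :=
  forall x y t, f (toward x y t) = f x + t * (f y - f x).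

(** The second clause prolongs segments of [K] a little beyond their endpoints: relative openness
    without a topology. *)
Definition relopen_convex K : Prop :=
  (forall x y t, K x -> K y -> 0 <= t <= 1 -> K (toward x y t)) /\
  (forall x y, K x -> K y -> small (fun t => K (toward x y t))).

Lemma relopen_convex_gt0 K (f : V -> R) : affine f -> relopen_convex K ->
  relopen_convex (K `&` [set y | 0 < f y]).
Proof.
move=> af [cK oK]; split=> [x y t [Kx fx] [Ky fy] t01|x y [Kx fx] [Ky fy]].
  split; first exact: cK.
  rewrite /= af; rewrite /= in fx fy; nra.
apply: small_sub (small_and (oK _ _ Kx Ky) (small_gt0 (f y - f x) fx)) => t [] *.
by split=> //=; rewrite af.
Qed.

Lemma relopen_convex_eq0 K (f : V -> R) : affine f -> relopen_convex K ->
  relopen_convex (K `&` [set y | f y = 0]).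
Proof.
move=> af [cK oK]; split=> [x y t [Kx fx] [Ky fy] t01|x y [Kx fx] [Ky fy]].
  by split; [exact: cK|rewrite /= af fx fy subrr mulr0 addr0].
apply: small_sub (oK _ _ Kx Ky) => t Kt.
by split=> //=; rewrite af fx fy subrr mulr0 addr0.
Qed.

Definition nonneg_part f W K : set V :=
  [set y | K y /\ forall i, i \in W -> 0 <= f i y].

(** On [nonneg_part] all signs are 0 or +, so the zero set is the whole pattern, and the pattern of
    [y'] is a degeneration of that of [y]. *)
Definition zeros_le f W y y' : Prop :=
  forall i, i \in W -> f i y = 0 -> f i y' = 0.

Definition zeros_eq f W y y' : Prop := zeros_le f W y y' /\ zeros_le f W y' y.

(* The value of [h] encodes an acyclic perfect matching on the sign patterns
   of the points of [nonneg_part f W K]: two patterns with the same value are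
   matched. *)
Definition perfectly_paired f W K : Prop :=
  exists (h : V -> nat) (N : nat), [/\ forall y, (h y < N)%N,
    forall y y', nonneg_part f W K y -> nonneg_part f W K y' ->
      zeros_le f W y y' -> (h y <= h y')%N,
    forall y, nonneg_part f W K y -> exists2 y', nonneg_part f W K y' &
      [/\ h y' = h y, ~ zeros_eq f W y y' &
          zeros_le f W y y' \/ zeros_le f W y' y] &
    forall y1 y2 y3, nonneg_part f W K y1 -> nonneg_part f W K y2 ->
      nonneg_part f W K y3 -> h y1 = h y2 -> h y1 = h y3 ->
      [\/ zeros_eq f W y1 y2, zeros_eq f W y1 y3 | zeros_eq f W y2 y3]].

(* Perturbing [y] breaks all ties that are not identities on [K]. *)
Lemma generic_maximum g W K O y0 i0 : (forall i, affine (g i)) -> i0 \in W ->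
  O y0 -> O `<=` K ->
  (forall y z, O y -> K z -> small (fun t => O (toward y z t))) ->
  exists2 m, m \in W & exists2 y, O y &
    forall i, i \in W -> {in K, g i =1 g m} \/ g i y < g m y.
Proof.
move=> ag i0W Oy0 OK opO; elim: W i0 i0W => // i W IH i0 _.
case: W IH => [_|j W /(_ _ (mem_head _ _)) [m mW [y Oy hy]]].
  exists i; first exact: mem_head.
  by exists y0 => // k; rewrite inE => /eqP ->; left.
set W' := j :: W in mW hy *.
have [eq_im|neq_im] := pselect {in K, g i =1 g m}.
  exists m; first by rewrite inE mW orbT.
  exists y => // k; rewrite inE => /orP[/eqP ->|/hy]; by [left|].
have [z Kz neq_z] : exists2 z, K z & g i z != g m z.
  apply: contrapT => H; apply: neq_im => z /set_mem Kz.
  by apply/eqP; apply: contrapT => /negP nz; apply: H; exists z.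
have [lt_im|gt_im|tie] := ltgtP (g i y) (g m y).
- exists m; first by rewrite inE mW orbT.
  exists y => // k; rewrite inE => /orP[/eqP ->|/hy]; by [right|].
- exists i; first exact: mem_head.
  exists y => // k; rewrite inE => /orP[/eqP ->|/hy []]; first by left.
    by move=> e; right; rewrite e ?inE//; exact: OK.
  by move=> e; right; apply: lt_trans e gt_im.
(* Strict inequalities already won by [m] survive a small move, so only the tie between [i] and [m]
   is left to break. *)
have keep k : k \in W' -> small (fun t =>
    {in K, g k =1 g m} \/ g k (toward y z t) < g m (toward y z t)).
  move=> /hy [e|lt]; first by exists 1 => // t _; left.
  have : 0 < g m y - g k y by rewrite subr_gt0.
  move/(small_gt0 ((g m z - g m y) - (g k z - g k y))).
  apply: small_sub => t; rewrite mulrBr addrACA -opprD -!ag subr_gt0.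
  by right.
have [t t0 [[in1 k1] [in2 k2]]] := small_pos (small_and (opO _ _ Oy Kz) (small_all keep)).
have mem_m : m \in i :: W' by rewrite inE mW orbT.
(* Along the line through [z] the difference of [g i] and [g m] changes sign at [y]; its sign at [z]
   tells which way to move, towards [z] or away from it, for [m] to win. *)
have [lt_z|gt_z|e] := ltgtP (g i z) (g m z); last by rewrite e eqxx in neq_z.
- exists m => //; exists (toward y z t) => // k.
  rewrite inE => /orP[/eqP ->|/k1//]; right.
  rewrite !ag tie ltrD2l ltr_pM2l// ltrD2r//.
- exists m => //; exists (toward y z (- t)) => // k.
  rewrite inE => /orP[/eqP ->|/k2//]; right.
  by rewrite !ag tie ltrD2l !mulNr ltrN2 ltr_pM2l// ltrD2r.
Qed.

(** Positive rescaling changes no sign; it will normalise all functions to one value at the base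
    point. *)
Lemma perfectly_paired_scale f g W K :
  (forall i, i \in W -> exists2 c, 0 < c & forall y, g i y = c * f i y) ->
  perfectly_paired g W K -> perfectly_paired f W K.
Proof.
move=> sc.
have eN : nonneg_part f W K = nonneg_part g W K.
  apply/seteqP; split=> y [Ky h]; split=> // i iW; have [c c0 e] := sc _ iW.
    by rewrite e; apply: mulr_ge0; [exact: ltW|exact: h].
  by have := h _ iW; rewrite e pmulr_rge0.
have eZ y y' : zeros_le f W y y' = zeros_le g W y y'.
  apply/propext; split=> h i iW; have [c c0 e] := sc _ iW; have := h _ iW.
    rewrite !e => h' /eqP; rewrite mulf_eq0 (gt_eqF c0) /= => /eqP /h' ->.
    by rewrite mulr0.
  rewrite !e => h' fy; move: h'; rewrite fy mulr0 => /(_ erefl) /eqP.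
  by rewrite mulf_eq0 (gt_eqF c0) => /eqP.
move=> [h [N H]]; exists h, N; rewrite eN.
have -> : zeros_le f W = zeros_le g W by apply/funext => y; apply/funext => y'.
have -> : zeros_eq f W = zeros_eq g W.
  by apply/funext => y; apply/funext => y'; rewrite /zeros_eq !eZ.
exact: H.
Qed.

(** Induction on the number of functions. Once each function is -1 at [x0], one with value v at [y]
    vanishes on the way from [y] to [x0] at parameter v / (1 + v), which grows with v. The last to
    vanish is thus the largest at [y], and genericity makes it unique up to equality on [K]. *)
Lemma perfectly_paired_visible f W K x0 :
  (forall i, affine (f i)) -> relopen_convex K -> K x0 -> W != [::] ->
  (forall i, i \in W -> f i x0 < 0) -> perfectly_paired f W K.
Proof.
have [n] := ubnP (size W); elim: n W f K x0 => // n IH W f K x0 szW af rK Kx0 W0 neg.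
pose g i y := (- f i x0)^-1 * f i y.
have g0 i : i \in W -> g i x0 = -1.
  by move=> iW; rewrite /g invrN mulNr mulVf// lt_eqF// neg.
have ag i : affine (g i) by move=> x y t; rewrite /g af; ring.
apply: (@perfectly_paired_scale f g).
  by move=> i iW; exists (- f i x0)^-1; rewrite // invr_gt0 oppr_gt0 neg.
have [cK oK] := rK.
have [[y1 [Ky1 y1pos]]|G0] := pselect (nonneg_part g W K !=set0); last first.
  exists (fun=> 0%N), 1%N; split=> // y.
    by move=> Gy; case: G0; exists y.
  by move=> y2 y3 Gy; case: G0; exists y.
have [i0 i0W] : exists i0, i0 \in W.
  by case: (W) W0 => // i ? _; exists i; exact: mem_head.
(* Moving away from [x0], at parameter -t, turns a value v >= 0 into v + t * (1 + v) > 0. *)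
have [t t0 [_ Kt]] := small_pos (oK _ _ Ky1 Kx0).
pose Kpos := K `&` [set y | forall i, i \in W -> 0 < g i y].
have Kpos0 : Kpos (toward y1 x0 (- t)).
  split=> // i iW; rewrite ag g0//; have := y1pos i iW; nra.
have opKpos y z : Kpos y -> K z -> small (fun t => Kpos (toward y z t)).
  move=> [Ky ypos] Kz; have sm i : i \in W -> small (fun t => 0 < g i (toward y z t)).
    move=> iW; apply: small_sub (small_gt0 (g i z - g i y) (ypos i iW)) => u.
    by rewrite ag.
  by apply: small_sub (small_and (oK _ _ Ky Kz) (small_all sm)).
have [m mW [y [Ky ypos] ymax]] := generic_maximum ag i0W Kpos0 (@subIsetl _ _ _) opKpos.
(* Functions equal to [g m] on [K] share its zeros and are dropped; [m] is one of them, so the list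
   gets shorter. *)
pose W' := [seq i <- W | ~~ `[<{in K, g i =1 g m}>]].
have same i z : i \in W -> i \notin W' -> K z -> g i z = g m z.
  move=> iW; rewrite mem_filter iW andbT negbK => /asboolP e Kz.
  by apply: e; exact/mem_set.
have W'W i : i \in W' -> i \in W by rewrite mem_filter => /andP[].
have lt_m i : i \in W' -> g i y < g m y.
  rewrite mem_filter => /andP[/asboolP nT iW].
  by case: (ymax i iW).
have mW' : m \notin W'.
  by rewrite mem_filter mW andbT negbK; apply/asboolP.
have szW' : (size W' < n)%N.
  apply: (@leq_trans (size W)); last by rewrite -ltnS.
  rewrite size_filter -(count_predC (fun i => ~~ `[<{in K, g i =1 g m}>])).
  rewrite -addn1 leq_add2l -has_count; apply/hasP; exists m => //=.
  by rewrite negbK; apply/asboolP.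
have gmy := ypos m mW.
pose tm := g m y / (1 + g m y).
have tm0 : 0 < tm by rewrite divr_gt0// addr_gt0.
have tm1 : tm <= 1 by rewrite ler_pdivrMr ?addr_gt0//; lra.
have tmE : tm * (1 + g m y) = g m y by rewrite divfK// gt_eqF// addr_gt0.
(* [p] is where [g m] vanishes; the functions in [W'], being smaller at [y], are already negative
   there. *)
pose p := toward y x0 tm.
have Kp : K p by apply: cK => //; lra.
have gmp : g m p = 0 by rewrite ag g0//; lra.
have gip i : i \in W' -> g i p < 0.
  move=> iW'; rewrite ag g0 ?W'W//; have := lt_m i iW'.
  have := ypos i (W'W _ iW'); nra.
(* With one function up to equality on [K] there are just two patterns, zero and positive, realised
   by [p] and [y] and paired together. *)
have [W'0|W'0] := eqVneq W' [::].
  have all_m i z : i \in W -> K z -> g i z = g m z.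
    by move=> iW; apply: same; rewrite // W'0.
  have Gp : nonneg_part g W K p by split=> // i iW; rewrite all_m// gmp.
  have Gy : nonneg_part g W K y by split=> // i iW; rewrite ltW// ypos.
  have zle z z' : nonneg_part g W K z -> nonneg_part g W K z' ->
      zeros_le g W z z' <-> (g m z = 0 -> g m z' = 0).
    move=> [Kz _] [Kz' _]; split; first by apply.
    by move=> h i iW; rewrite !all_m.
  exists (fun=> 0%N), 1%N; split=> //.
    move=> z Gz; have [gz|gz] := eqVneq (g m z) 0.
      exists y => //; split=> //.
        by move=> [/zle] /(_ Gz Gy gz) e; rewrite e ltxx in gmy.
      by right; apply/zle => // e; rewrite e ltxx in gmy.
    exists p => //; split=> //.
      by move=> [_ /zle] /(_ Gp Gz gmp) e; rewrite e eqxx in gz.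
    by left; apply/zle.
  move=> y2 y3 y4 G2 G3 G4 _ _.
  have eqz z z' : nonneg_part g W K z -> nonneg_part g W K z' ->
      (g m z == 0) = (g m z' == 0) -> zeros_eq g W z z'.
    move=> Gz Gz' e; split; apply/zle => // /eqP; first by rewrite e => /eqP.
    by rewrite -e => /eqP.
  have [e|] := eqVneq (g m y2 == 0) (g m y3 == 0); first by apply: Or31; apply: eqz.
  have [e|] := eqVneq (g m y2 == 0) (g m y4 == 0); first by move=> _; apply: Or32; apply: eqz.
  move=> n1 n2; apply: Or33; apply: eqz => //.
  by move: n1 n2; case: (g m y2 == 0); case: (g m y3 == 0); case: (g m y4 == 0).
pose K1 := K `&` [set z | 0 < g m z]; pose K0 := K `&` [set z | g m z = 0].
have sm i : i \in W' -> small (fun t => g i (toward p y t) < 0).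
  move=> iW'; apply: small_sub (small_lt0 (g i y - g i p) (gip i iW')) => u.
  by rewrite ag.
(* A small step back from [p] to [y] makes [g m] positive and keeps [W'] negative: this is the base
   point for [K1], while [p] serves [K0]. *)
have [s s0 [[Kq qneg] _]] := small_pos (small_and (oK _ _ Kp Ky) (small_all sm)).
have K1q : K1 (toward p y s).
  by split=> //=; rewrite ag gmp add0r subr0 mulr_gt0.
have [h1 [N1 [b1 mono1 ex1 fib1]]] :=
  IH W' g K1 _ szW' ag (relopen_convex_gt0 (ag m) rK) K1q W'0 qneg.
have [h0 [N0 [b0 mono0 ex0 fib0]]] :=
  IH W' g K0 p szW' ag (relopen_convex_eq0 (ag m) rK) (conj Kp gmp) W'0 gip.
have G1E z : nonneg_part g W' K1 z <-> nonneg_part g W K z /\ 0 < g m z.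
  split=> [[[Kz mz] zpos]|[[Kz zpos] mz]]; last first.
    by split=> // i /W'W; apply: zpos.
  split=> //; split=> // i iW; have [/zpos//|iW'] := boolP (i \in W').
  by rewrite same// ltW.
have G0E z : nonneg_part g W' K0 z <-> nonneg_part g W K z /\ g m z = 0.
  split=> [[[Kz mz] zpos]|[[Kz zpos] mz]]; last first.
    by split=> // i /W'W; apply: zpos.
  split=> //; split=> // i iW; have [/zpos//|iW'] := boolP (i \in W').
  by rewrite same// mz.
have zlE z z' : K z -> K z' ->
    zeros_le g W z z' <-> zeros_le g W' z z' /\ (g m z = 0 -> g m z' = 0).
  move=> Kz Kz'; split=> [h|[h hm] i iW].
    by split; [move=> i /W'W; apply: h|apply: h].
  by have [/h//|iW'] := boolP (i \in W'); rewrite !same.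
have zeE z z' : K z -> K z' -> (g m z == 0) = (g m z' == 0) ->
    zeros_eq g W' z z' -> zeros_eq g W z z'.
  move=> Kz Kz' e [l r]; split; apply/zlE => //; split=> // /eqP.
    by rewrite e => /eqP.
  by rewrite -e => /eqP.
have dich z : nonneg_part g W K z ->
   (nonneg_part g W' K1 z /\ 0 < g m z) \/ (nonneg_part g W' K0 z /\ g m z = 0).
  move=> Gz; have := Gz.2 m mW; rewrite le_eqVlt => /orP[/eqP/esym e|e].
    by right; split=> //; apply/G0E.
  by left; split=> //; apply/G1E.
(* A degeneration may pass from [K1] to [K0] but not back, so heights on [K0] are shifted above
   those on [K1]; the bound [N1] also keeps the two ranges disjoint. *)
pose h z := if 0 < g m z then h1 z else (N1 + h0 z)%N.
have hpos z : 0 < g m z -> h z = h1 z by rewrite /h => ->.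
have hzero z : g m z = 0 -> h z = (N1 + h0 z)%N by rewrite /h => ->; rewrite ltxx.
exists h, (N1 + N0)%N; split.
- move=> z; rewrite /h; case: ifP => _; last by rewrite ltn_add2l.
  by apply: leq_trans (b1 z) (leq_addr _ _).
- move=> z z' Gz Gz' /zlE []; [exact: Gz.1|exact: Gz'.1|move=> le_z le_m].
  have [[G1 p1]|[Gz0 e0]] := dich z Gz; have [[G1' p1']|[Gz0' e0']] := dich z' Gz'.
  + by rewrite !hpos//; apply: mono1.
  + rewrite hpos// hzero//; apply: leq_trans (ltnW (b1 z)) (leq_addr _ _).
  + by move: p1'; rewrite le_m// ltxx.
  + by rewrite !hzero// leq_add2l; apply: mono0.
- move=> z Gz; have [[G1 p1]|[Gz0 e0]] := dich z Gz.
    have [z' /[dup] G1' /G1E [Gz' p1'] [eh nz cmp]] := ex1 z G1; exists z' => //; split.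
    + by rewrite !hpos.
    + by move=> [/zlE l /zlE r]; apply: nz; split; [apply l|apply r];
        [exact: Gz.1|exact: Gz'.1|exact: Gz'.1|exact: Gz.1].
    + have p1z := gt_eqF p1; have p1z' := gt_eqF p1'.
      case: cmp => c; [left|right]; apply/zlE;
        [exact: Gz.1|exact: Gz'.1|split=> // /eqP |exact: Gz'.1|exact: Gz.1|split=> // /eqP].
        by rewrite p1z.
      by rewrite p1z'.
  have [z' /[dup] G0' /G0E [Gz' e0'] [eh nz cmp]] := ex0 z Gz0; exists z' => //; split.
  + by rewrite !hzero// eh.
  + by move=> [/zlE l /zlE r]; apply: nz; split; [apply l|apply r];
        [exact: Gz.1|exact: Gz'.1|exact: Gz'.1|exact: Gz.1].
  + by case: cmp => c; [left|right]; apply/zlE;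
      [exact: Gz.1|exact: Gz'.1|split=> // |exact: Gz'.1|exact: Gz.1|split=> //].
- have part z z' : nonneg_part g W K z -> nonneg_part g W K z' -> h z = h z' ->
      (g m z == 0) = (g m z' == 0).
    move=> Gz Gz'.
    have [[_ p1]|[_ e0]] := dich z Gz; have [[_ p1']|[_ e0']] := dich z' Gz'.
    + by rewrite !gt_eqF.
    + by rewrite hpos// hzero// => e; have := b1 z; rewrite e ltnNge leq_addr.
    + by rewrite hzero// hpos// => e; have := b1 z'; rewrite -e ltnNge leq_addr.
    + by rewrite e0 e0'.
  move=> z1 z2 z3 G1 G2 G3 h12 h13.
  have e12 := part _ _ G1 G2 h12; have e13 := part _ _ G1 G3 h13.
  have [K1' K2' K3'] : [/\ K z1, K z2 & K z3] by split; [exact: G1.1|exact: G2.1|exact: G3.1].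
  have concl : [\/ zeros_eq g W' z1 z2, zeros_eq g W' z1 z3 | zeros_eq g W' z2 z3] ->
     [\/ zeros_eq g W z1 z2, zeros_eq g W z1 z3 | zeros_eq g W z2 z3].
    by case=> e; [apply: Or31|apply: Or32|apply: Or33]; apply: zeE => //; rewrite -e12.
  apply: concl.
  have [[H1 p1]|[H1 p1]] := dich z1 G1; have [[H2 p2]|[H2 p2]] := dich z2 G2;
    try by move: e12; rewrite ?p1 ?p2 eqxx ?(gt_eqF p1) ?(gt_eqF p2).
    have [[H3 p3]|[_ p3]] := dich z3 G3; last by move: e13; rewrite p3 eqxx (gt_eqF p1).
    by move: h12 h13; rewrite !hpos//; apply: fib1.
  have [[_ p3]|[H3 p3]] := dich z3 G3; first by move: e13; rewrite p1 eqxx (gt_eqF p3).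
  by move: h12 h13; rewrite !hzero// => /addnI h12 /addnI; apply: fib0.
Qed.

End VisibleSigns.

(** * Acyclic matchings from gradings, and their unions *)

(** An alias that carries inclusion as its order, so that finite sets can be values of a compact
    grading. *)
Definition fset_incl (I : choiceType) : Type := {fset I}.
HB.instance Definition _ (I : choiceType) := Choice.on (fset_incl I).

Section FsetInclusionOrder.
Variable I : choiceType.
Definition fset_incl_le (A B : fset_incl I) : bool := fsubset A B.
Lemma fset_incl_refl : reflexive fset_incl_le.
Proof. by move=> A; exact: fsubset_refl. Qed.
Lemma fset_incl_anti : antisymmetric fset_incl_le.
Proof. by move=> A B; rewrite /fset_incl_le -eqEfsubset => /eqP. Qed.
Lemma fset_incl_trans : transitive fset_incl_le.
Proof. by move=> A B C; exact: fsubset_trans. Qed.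
HB.instance Definition _ := @Order.Le_isPOrder.Build Order.default_display
  (fset_incl I) fset_incl_le fset_incl_refl fset_incl_anti fset_incl_trans.
End FsetInclusionOrder.

(** * Matchings whose edges are fibres of a grading *)

Section AbstractMatchings.
Variables (T : Type) (lt : T -> T -> Prop).
Implicit Types (P : set T) (p q r : T) (M : set (T * T)).

Definition fibre_matching P (I : choiceType) (w : T -> {fset I}) (h : T -> nat) :
    set (T * T) :=
  [set e | [/\ P e.1, P e.2, lt e.2 e.1, w e.1 = w e.2 & h e.1 = h e.2]].

(** An element strictly between two matched ones would be a third member of their fibre, so matched
    pairs are covers. Along oriented edges (w, h) weakly decreases lexicographically, and a path
    that stays in one fibre only climbs, because a descent inside a fibre is a matched edge. A cycle
    would thus give [lt p p]. *)
Lemma fibre_matching_proper P (I : choiceType) (w : T -> {fset I}) (h : T -> nat) :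
  (forall p, ~ lt p p) ->
  (forall p q r, P p -> P q -> P r -> lt p q -> lt q r -> lt p r) ->
  (forall p q, P p -> P q -> lt q p ->
     fsubset (w q) (w p) /\ (w q = w p -> (h q <= h p)%N)) ->
  (forall X, finite_set [set p | P p /\ fsubset (w p) X]) ->
  (forall p q r, P p -> P q -> P r -> w p = w q -> w p = w r ->
     h p = h q -> h p = h r -> [\/ p = q, p = r | q = r]) ->
  proper_acyclic_matching P lt (fibre_matching P w h).
Proof.
move=> irr tr mono fin fib; split.
- split.
    move=> [p q] [/= Pp Pq ltqp ew eh]; split=> //= -[r [Pr qr rp]].
    have [sqr hqr] := mono _ _ Pr Pq qr.
    have [srp hrp] := mono _ _ Pp Pr rp.
    have erp : w r = w p.
      by apply/eqP; rewrite eqEfsubset srp ew.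
    have eqr : w q = w r by rewrite erp.
    have hr : h r = h p.
      apply/eqP; rewrite eqn_leq hrp//= eh hqr//.
    case: (fib p q r Pp Pq Pr ew (esym erp) eh (esym hr)) => e; subst => //.
    - exact: irr ltqp.
    - exact: irr rp.
    - exact: irr qr.
  move=> p [p1 q1] [p2 q2] [/= P1 Q1 l1 w1 h1] [/= P2 Q2 l2 w2 h2].
  have aux a b : P a -> P b -> lt a b -> lt b a -> False.
    by move=> Pa Pb ab ba; exact: irr (tr _ _ _ Pa Pb Pa ab ba).
  rewrite /in_edge /= => -[] e1 [] e2; subst.
  + case: (fib p q1 q2) => // e; subst => //; by case: (irr _ l1) || case: (irr _ l2).
  + case: (fib p q1 p2) => //; try congruence.
    * by move=> e; subst; case: (irr _ l1).
    * by move=> e; subst; case: (irr _ l2).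
    * by move=> e; subst; case: (aux _ _ P1 Q1).
  + case: (fib p p1 q2) => //; try congruence.
    * by move=> e; subst; case: (irr _ l1).
    * by move=> e; subst; case: (irr _ l2).
    * by move=> e; subst; case: (aux _ _ P1 Q1).
  + case: (fib p p1 p2) => //; try congruence.
    * by move=> e; subst; case: (irr _ l1).
    * by move=> e; subst; case: (irr _ l2).
- have key p q : clos_trans T (oriented P lt (fibre_matching P w h)) p q ->
     [/\ P p, P q, fsubset (w q) (w p), w q = w p -> (h q <= h p)%N &
         w q = w p -> h q = h p -> lt p q].
    elim=> {p q} [p q [[[/= Pp Pq qp _] nM]|[[/= Pq Pp _ _] [/= _ _ pq ew eh]]]|].
    - have [sqp hqp] := mono _ _ Pp Pq qp; split=> // ew eh; case: nM.
      by split.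
    - by split=> //; rewrite ?ew ?eh.
    - move=> p q r _ [Pp Pq s1 h1 l1] _ [_ Pr s2 h2 l2].
      have eqs : w r = w p -> w q = w p.
        by move=> e; apply/eqP; rewrite eqEfsubset s1 -e.
      split=> //; first exact: fsubset_trans s2 s1.
        move=> /[dup] e /eqs eq; apply: leq_trans (h2 _) (h1 eq).
        by rewrite eq.
      move=> /[dup] e /eqs eq eh.
      have erq : w r = w q by rewrite eq.
      have hq : h q = h p by apply/eqP; rewrite eqn_leq h1//= -eh h2.
      apply: (tr p q r) => //; [exact: l1|apply: l2 => //].
      by rewrite eh hq.
  by move=> p /key [_ _ _ _ l]; apply: (irr p); apply: l.
- exists Order.default_display, (fset_incl I), w; split; first split.
  + by move=> p q Pp Pq /(mono _ _ Pq Pp) [].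
  + exact: fin.
  + by move=> e [].
Qed.

End AbstractMatchings.

(** * Gluing matchings along an indexed decomposition *)

Section Patchwork.
Variables (T J : Type) (P : set T) (lt : T -> T -> Prop).
Variables (E : set J) (N : J -> set T) (idx : J -> nat) (M : J -> set (T * T)).
Implicit Types (p q r : T) (C D : J).
Hypothesis P_cover : forall p, P p <-> exists2 C, E C & N C p.
Hypothesis N_disjoint : forall C D p, E C -> E D -> N C p -> N D p -> C = D.
Hypothesis N_mono : forall C D p q, E C -> E D -> N C p -> N D q -> lt p q ->
  C = D \/ (idx C < idx D)%N.
Hypothesis lower_finite : forall q, P q -> finite_set [set p | P p /\ lt p q].
Hypothesis M_proper : forall C, E C -> proper_acyclic_matching (N C) lt (M C).

Let U : set (T * T) := \bigcup_(C in E) M C.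

Lemma patch_edge C e : E C -> M C e -> [/\ N C e.1, N C e.2 & lt e.2 e.1].
Proof. by move=> EC Me; have [[/(_ _ Me) [? ? ? _] _] _ _] := M_proper EC. Qed.

(** An element of another piece between two elements of [N C] would have an index both larger and
    smaller than that of [C]. *)
Lemma patch_hasse C e : E C -> N C e.1 -> N C e.2 ->
  hasse_edge P lt e <-> hasse_edge (N C) lt e.
Proof.
move=> EC N1 N2; split=> -[_ _ l cov]; split=> //.
- by move=> [r [Nr l1 l2]]; apply: cov; exists r; split=> //; apply/P_cover; exists C.
- by apply/P_cover; exists C.
- by apply/P_cover; exists C.
- move=> [r [/P_cover[D ED Nr] l1 l2]]; apply: cov; exists r; split=> //.
  case: (N_mono EC ED N2 Nr l1) => [->//|lt1].
  case: (N_mono ED EC Nr N1 l2) => [<-//|lt2].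
  by move: (ltn_trans lt1 lt2); rewrite ltnn.
Qed.

Lemma patch_matching : is_matching P lt U.
Proof.
split.
  move=> e [C EC Me]; have [N1 N2 _] := patch_edge EC Me.
  apply/(patch_hasse EC N1 N2); have [[sub _] _ _] := M_proper EC; exact: sub.
move=> p e f [C EC Me] [D ED Mf] pe pf.
have NC : N C p by have [N1 N2 _] := patch_edge EC Me; case: pe => <-.
have ND : N D p by have [N1 N2 _] := patch_edge ED Mf; case: pf => <-.
have CD := N_disjoint EC ED NC ND; subst D.
by have [[_ uniq] _ _] := M_proper EC; apply: uniq pe pf.
Qed.

(** Matched edges stay in one piece and descents do not raise the index, so a cycle lies in a single
    piece, where the matching is acyclic. *)
Lemma patch_acyclic : acyclic P lt U.
Proof.
have key p q : clos_trans T (oriented P lt U) p q -> forall C, E C -> N C p ->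
    exists2 D, E D & N D q /\ ((D = C /\ clos_trans T (oriented (N C) lt (M C)) p q) \/
                     (idx D < idx C)%N).
  elim=> {p q} [p q or C EC Np|p q r _ IH1 _ IH2 C EC /(IH1 C EC)].
    case: or => -[hs Upq].
      have [/= _ /P_cover[D ED Nq] l _] := hs; exists D => //; split=> //.
      case: (N_mono ED EC Nq Np l) => [e|]; [left|by right]; subst D; split=> //.
      apply: t_step; left; split; first exact/(patch_hasse EC).
      by move=> Mpq; apply: Upq; exists C.
    have [D ED Mqp] := Upq; have [/= Nq Np' _] := patch_edge ED Mqp.
    have e := N_disjoint EC ED Np Np'; subst D; exists C => //; split=> //; left; split=> //.
    by apply: t_step; right; split=> //; apply/(patch_hasse EC).
  move=> [D ED [Nq cq]]; have [F EF [Nr cr]] := IH2 D ED Nq.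
  exists F => //; split=> //; case: cq => [[e pq]|lq].
    subst D; case: cr => [[e qr]|]; last by right.
    by subst F; left; split=> //; apply: t_trans pq qr.
  by right; case: cr => [[-> _]//|lr]; apply: ltn_trans lr lq.
move=> p c.
have Pp : P p by elim: c => // a b [] [] [].
have [C EC Np] := (P_cover p).1 Pp.
have [D ED [Np']] := key _ _ c C EC Np.
have -> := N_disjoint ED EC Np' Np; rewrite ltnn => -[[_ cc]|//].
by have [_ ac _] := M_proper EC; exact: ac cc.
Qed.

Lemma patch_critical : critical P U = \bigcup_(C in E) critical (N C) (M C).
Proof.
apply/seteqP; split=> p.
  move=> [/P_cover[C EC Np] cr]; exists C => //; split=> // e Me; apply: cr.
  by exists C.
move=> [C EC [Np cr]]; split; first by apply/P_cover; exists C.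
move=> e [D ED Me] pe; have [N1 N2 _] := patch_edge ED Me.
have Np' : N D p by case: pe => <-.
by have DC := N_disjoint ED EC Np' Np; subst D; exact: cr Me pe.
Qed.

(** Matched elements reach each other, so the set of reachable elements is constant on matched
    pairs; it also grows along [lt]. *)
Definition patch_step p q : Prop := P p /\ P q /\ (lt q p \/ U (q, p)).

Definition patch_reach p : set T := [set q | clos_refl_trans T patch_step p q].

(** Induction on the index. While a path stays in its piece, it stays in a finite sublevel set of
    the grading of that piece; it leaves by descending to one of the finitely many elements below
    this set that have smaller index. *)
Lemma patch_reach_finite C p : E C -> N C p -> finite_set (patch_reach p).
Proof.
have [n] := ubnP (idx C); elim: n C p => // n IH C p ltCn EC Np.
have [_ _ [d [Q [phi [[mono fin] eqM]]]]] := M_proper EC.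
pose B0 := [set q | N C q /\ (phi q <= phi p)%O].
pose low q := [set r | (P r /\ lt r q) /\ exists D, [/\ E D, N D r & (idx D < idx C)%N]].
pose B := B0 `|` \bigcup_(q in B0) \bigcup_(r in low q) patch_reach r.
apply: (@sub_finite_set _ _ B); last first.
  rewrite finite_setU; split; first exact: fin.
  apply: bigcup_finite; first exact: fin.
  move=> q [Nq _]; apply: bigcup_finite.
    apply: sub_finite_set (lower_finite (q := q) _); first by move=> r [].
    by apply/P_cover; exists C.
  by move=> r [_ [D [ED Nr lD]]]; apply: (IH D) => //; apply: leq_trans lD _.
suff key a b : clos_refl_trans T patch_step a b -> B a -> B b.
  by move=> q /key; apply; left; split.
elim=> {a b} [a b st|//|a b c _ h1 _ h2 /h1/h2//].
case=> [[Na le_a]|[q Bq [r lr ra]]]; last first.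
  by right; exists q => //; exists r => //; apply: rt_trans ra (rt_step _ _ _ _ st).
have [Pa [Pb [ltba|Uba]]] := st.
  have [D ED Nb] := (P_cover b).1 Pb.
  have [e|ltD] := N_mono ED EC Nb Na ltba.
    by subst D; left; split=> //; apply: le_trans (mono _ _ Nb Na ltba) le_a.
  right; exists a; first by split.
  by exists b; [split=> //; exists D|exact: rt_refl].
have [D ED Mba] := Uba; have [/= Nb Na' _] := patch_edge ED Mba.
have e := N_disjoint EC ED Na Na'; subst D; left; split=> //.
by rewrite (eqM _ Mba).
Qed.

Lemma patch_step_reach p q : patch_step p q -> patch_reach q `<=` patch_reach p.
Proof. by move=> st r; apply: rt_trans; exact: rt_step. Qed.

End Patchwork.

(** The grading is the finite set of reachable elements. It contains the element itself, so the
    sublevel set at [X] is contained in [X]. *)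
Lemma patchwork (T : choiceType) (J : Type) (P : set T) (lt : T -> T -> Prop)
    (E : set J) (N : J -> set T) (idx : J -> nat) (M : J -> set (T * T)) :
  (forall p, P p <-> exists2 C, E C & N C p) ->
  (forall C D p, E C -> E D -> N C p -> N D p -> C = D) ->
  (forall C D p q, E C -> E D -> N C p -> N D q -> lt p q ->
     C = D \/ (idx C < idx D)%N) ->
  (forall q, P q -> finite_set [set p | P p /\ lt p q]) ->
  (forall C, E C -> proper_acyclic_matching (N C) lt (M C)) ->
  proper_acyclic_matching P lt (\bigcup_(C in E) M C).
Proof.
move=> cov dis mono low prop; split.
- exact: patch_matching cov dis mono prop.
- exact: patch_acyclic cov dis mono prop.
pose phi p : fset_incl T := if `[<P p>] then fset_set (patch_reach P lt E M p) else fset0.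
have fin p : P p -> finite_set (patch_reach P lt E M p).
  by move=> /cov[C EC Np]; exact: patch_reach_finite cov dis mono low prop C p EC Np.
have phiE p : P p -> phi p = fset_set (patch_reach P lt E M p).
  by move=> /asboolP; rewrite /phi => ->.
have step_le p q : patch_step P lt E M p q -> (phi q <= phi p)%O.
  move=> /[dup] st [Pp [Pq _]]; rewrite !phiE//; apply/fsubsetP => r.
  rewrite !in_fset_set ?inE; try exact: fin.
  exact: patch_step_reach.
exists Order.default_display, (fset_incl T), phi; split; first split.
- by move=> p q Pp Pq ltpq; apply: step_le; split=> //; split=> //; left.
- move=> X; apply: sub_finite_set (finite_fset X) => p [Pp].
  rewrite phiE// => /fsubsetP; apply.
  by rewrite in_fset_set ?inE; [exact: rt_refl|exact: fin].
- move=> [p q] Upq; have [C EC Mpq] := Upq.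
  have [Np Nq l] := patch_edge prop EC Mpq.
  have Pp : P p by apply/cov; exists C.
  have Pq : P q by apply/cov; exists C.
  apply/eqP; rewrite eq_le; apply/andP; split; apply: step_le; split=> //; split=> //.
    by right.
  by left.
Qed.

(** There are finitely many pairs of subsets of [X]; the two subsets will record signs at
    hyperplanes. *)
Lemma finite_by_subset_pairs (T : Type) (I : choiceType) (S : set T)
    (f g : T -> {fset I}) (X : {fset I}) :
  (forall p, S p -> fsubset (f p) X /\ fsubset (g p) X) ->
  (forall p q, S p -> S q -> f p = f q -> g p = g q -> p = q) ->
  finite_set S.
Proof.
move=> sub inj.
pose k p := if `[<S p>] then Some (f p, g p) else None.
pose B := [set Some (a, b) | a in [set` fpowerset X] & b in [set` fpowerset X]].
have kE p : S p -> k p = Some (f p, g p) by rewrite /k => /asboolP ->.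
have kS p : B (k p) -> S p.
  by rewrite /k; case: asboolP => // _ [a _ [b _]].
apply: (@sub_finite_set _ _ (k @^-1` B)).
  move=> p Sp; have [fX gX] := sub p Sp; rewrite /= kE//.
  by exists (f p); [rewrite /= fpowersetE|exists (g p); rewrite //= fpowersetE].
apply: finite_preimage; last by apply: finite_image2; exact: finite_fset.
move=> p q /set_mem/kS Sp /set_mem/kS Sq; rewrite !kE// => -[].
exact: inj.
Qed.

(** * Affine forms of hyperplanes *)

Section AffineForms.
Variables (R : realType) (n : nat).
Local Notation V := 'rV[R]_n.
Implicit Types (x y z v : V) (H : set V) (t : R).

Lemma affine_form_affine a b : affine (affine_form (n := n) (R := R) a b).
Proof.
move=> x y t.
by rewrite /affine_form /toward mulmxDl -scalemxAl mulmxBl !mxE; ring.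
Qed.

Lemma affine_form_continuous a b : continuous (affine_form (n := n) (R := R) a b).
Proof.
have -> : affine_form a b = (fun x : V => (\sum_i x 0 i * a i 0) - b).
  by apply/funext => y; rewrite /affine_form mxE.
move=> x; apply: (@cvgB _ _ _ (nbhs x) _ _ (fun=> b)); last exact: cvg_cst.
apply: (@cvg_big _ _ _ _ xpredT) => [|i _]; first exact: add_continuous.
by apply: cvgMr_tmp; exact: coord_continuous.
Qed.

Lemma toward_continuous x y : continuous (toward x y : R -> V).
Proof. by move=> t; apply: cvgD; [exact: cvg_cst|exact: scalel_continuous]. Qed.

Lemma toward0 x y : toward x y 0 = x.
Proof. by rewrite /toward scale0r addr0. Qed.

Lemma toward1 x y : toward x y 1 = y.
Proof. by rewrite /toward scale1r addrC subrK. Qed.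

Lemma toward_toward x y s t : toward x (toward x y s) t = toward x y (t * s).
Proof. by rewrite /toward addrAC subrr add0r scalerA. Qed.

Lemma affine_crossing (f : V -> R) x y : affine f -> f x * f y < 0 ->
  exists2 t, 0 <= t <= 1 & f (toward x y t) = 0.
Proof.
move=> af xy.
have [fx|fx|fx] := ltgtP (f x) 0; last by move: xy; rewrite fx mul0r ltxx.
  have fy : 0 < f y by move: xy; rewrite nmulr_rlt0.
  have d0 : f x - f y < 0 by lra.
  exists (f x / (f x - f y)); last by rewrite af; field; rewrite lt_eqF.
  by rewrite ler_ndivlMr// ler_ndivrMr//; apply/andP; split; lra.
have fy : f y < 0 by move: xy; rewrite pmulr_rlt0.
have d0 : 0 < f x - f y by lra.
exists (f x / (f x - f y)); last by rewrite af; field; rewrite gt_eqF.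
by rewrite ler_pdivlMr// ler_pdivrMr//; apply/andP; split; lra.
Qed.

Lemma sgr_eq_neq0 (a b : R) : a != 0 -> Num.sg a = Num.sg b <-> 0 < a * b.
Proof.
move=> a0; rewrite -sgr_gt0 sgrM; have [s|s|s] := ltgtP a 0; last by rewrite s eqxx in a0.
  rewrite (ltr0_sg s); have [u|u|->] := ltgtP b 0.
  - by rewrite (ltr0_sg u) mulrNN mulr1 ltr01.
  - by rewrite (gtr0_sg u); split=> e; exfalso; lra.
  - by rewrite sgr0; split=> e; exfalso; lra.
rewrite (gtr0_sg s); have [u|u|->] := ltgtP b 0.
- by rewrite (ltr0_sg u); split=> e; exfalso; lra.
- by rewrite (gtr0_sg u) mulr1 ltr01.
- by rewrite sgr0; split=> e; exfalso; lra.
Qed.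

(** One equation of [H], fixed once and for all. Another choice could flip the signs, but not
    whether two points have equal signs. The default (0, 0) gives the zero function. *)
Definition form H : V -> R :=
  let p := xget (0, 0) [set p : 'cV[R]_n * R | p.1 != 0 /\ H = hyperplane p.1 p.2] in
  affine_form p.1 p.2.

Lemma formP H : is_hyperplane H ->
  exists a b, [/\ a != 0, H = hyperplane a b & form H = affine_form a b].
Proof.
move=> [a [b [a0 Hab]]]; rewrite /form.
set P := [set p : 'cV[R]_n * R | _].
have [p0 ep] : P (xget (0, 0) P) by apply: xgetPex; exists (a, b).
by exists (xget (0, 0) P).1, (xget (0, 0) P).2.
Qed.

Lemma form_affine H : affine (form H).
Proof. exact: affine_form_affine. Qed.

Lemma form_eq0 H x : is_hyperplane H -> H x <-> form H x = 0.
Proof. by move=> /formP[a [b [_ e ->]]]; rewrite {1}e. Qed.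

(** If [g] changed sign between [x] and [y], its zero on the segment would be a zero of [f], which
    keeps its sign there. Sides of a hyperplane thus do not depend on the equation. *)
Lemma same_zeros_side (f g : V -> R) x y : affine f -> affine g ->
  (forall z, f z = 0 <-> g z = 0) -> 0 < f x * f y -> 0 < g x * g y.
Proof.
move=> af ag fg fxy; rewrite ltNge; apply/negP => gxy.
have [gx|gx] := eqVneq (g x) 0; first by move/fg : gx fxy => ->; rewrite mul0r ltxx.
have [gy|gy] := eqVneq (g y) 0; first by move/fg : gy fxy => ->; rewrite mulr0 ltxx.
have : g x * g y < 0 by rewrite lt_neqAle gxy mulf_neq0.
move=> /(affine_crossing ag)[t /andP[t0 t1] /fg]; rewrite af.
have [fx|fx|fx] := ltgtP (f x) 0; last by move: fxy; rewrite fx mul0r ltxx.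
  have fy : f y < 0 by nra.
  move=> e; nra.
have fy : 0 < f y by nra.
move=> e; nra.
Qed.

Lemma strictly_same_sideE H x y : is_hyperplane H ->
  strictly_same_side H x y <-> 0 < form H x * form H y.
Proof.
move=> hH; split=> [[a [b [a0 Hab]]]|].
  apply: same_zeros_side; [exact: affine_form_affine|exact: form_affine|].
  by move=> z; rewrite -form_eq0// Hab.
have [a [b [a0 Hab ->]]] := formP hH => h.
by exists a, b.
Qed.

Lemma hyperplane_affine_subspace H x : is_hyperplane H -> H x ->
  exists W, H = affine_subspace x W.
Proof.
move=> [a [b [a0 ->]]] /= Hx.
exists (lker (linfun (mulmxr a))).
apply/seteqP; split=> y /=; rewrite /affine_subspace /= memv_ker lfunE /= mulmxBl.
  move=> Hy; rewrite subr_eq0; apply/eqP/matrixP => i j; rewrite !ord1.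
  by move: Hx Hy; rewrite /affine_form => /eqP; rewrite subr_eq0 => /eqP -> /eqP; rewrite subr_eq0 => /eqP.
by rewrite subr_eq0 => /eqP e; rewrite /hyperplane /= /affine_form e.
Qed.

Lemma hyperplane_proper H : is_hyperplane H -> exists x, ~ H x.
Proof.
move=> [a [b [a0 ->]]]; have [i ai] : exists i, a i 0 != 0.
  apply: contrapT => h; move/eqP: a0; apply; apply/matrixP => i j.
  by rewrite ord1 mxE; apply/eqP; apply: contrapT => /negP ai; apply: h; exists i.
have [e|e] := pselect (hyperplane a b 0); last by exists 0.
exists (delta_mx 0 i); move: e; rewrite /hyperplane /= /affine_form mul0mx -rowE !mxE.
by rewrite sub0r => /eqP; rewrite oppr_eq0 => /eqP ->; rewrite subr0; apply/eqP.
Qed.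

End AffineForms.

(** * Faces, chambers and cells *)

Section Faces.
Variables (R : realType) (n : nat) (A : set (set 'rV[R]_n)).
Hypothesis hA : arrangement A.
Local Notation V := 'rV[R]_n.
Implicit Types (x y z v c d e : V) (H C D F X : set V) (t : R).

Let hyp H : A H -> is_hyperplane H. Proof. exact: hA.1. Qed.

Definition side H x : R := Num.sg (form H x).

Definition same_sides x y : Prop := forall H, A H -> side H x = side H y.

Definition face_at x : set V := closure (stratum A x).

Definition specializes x y : Prop :=
  forall H, A H -> form H y = 0 \/ side H y = side H x.

Lemma mem_hyperplane H x : A H -> H x <-> form H x = 0.
Proof. by move=> /hyp; exact: form_eq0. Qed.

Lemma side_eq0 H x : side H x = 0 <-> form H x = 0.
Proof. by split=> /eqP; rewrite ?sgr_eq0 => /eqP//; rewrite /side => ->; rewrite sgr0. Qed.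

Lemma side_eq_neq0 H x y : form H x != 0 ->
  side H x = side H y <-> 0 < form H x * form H y.
Proof. exact: sgr_eq_neq0. Qed.

Lemma side_neq_lt0 H x y : form H x != 0 -> form H y != 0 ->
  side H x <> side H y <-> form H x * form H y < 0.
Proof.
move=> fx fy; rewrite side_eq_neq0//; split=> [/negP|h /(lt_trans h)].
  by rewrite -leNgt le_eqVlt mulf_eq0 (negPf fx) (negPf fy).
by rewrite ltxx.
Qed.

Lemma same_stratumE x y : same_stratum A x y <-> same_sides x y.
Proof.
split=> h H AH.
  have [[Hx Hy]|/(strictly_same_sideE _ _ (hyp AH)) xy] := h H AH.
    by move/(mem_hyperplane _ AH)/side_eq0: Hx => ->;
       move/(mem_hyperplane _ AH)/side_eq0: Hy => ->.
  by apply/side_eq_neq0 => //; apply: contraTneq xy => ->; rewrite mul0r ltxx.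
have [fx|fx] := eqVneq (form H x) 0.
  left; split; apply/mem_hyperplane => //; apply/side_eq0.
  by rewrite -h//; apply/side_eq0.
by right; apply/strictly_same_sideE; [exact: hyp|apply/side_eq_neq0; rewrite // h].
Qed.

Lemma side_toward H x y t : 0 < t <= 1 ->
  form H x = 0 \/ side H x = side H y -> side H (toward x y t) = side H y.
Proof.
move=> /andP[t0 t1] hx; have [fy|fy] := eqVneq (form H y) 0.
  have fx : form H x = 0 by case: hx => // e; apply/side_eq0; rewrite e; apply/side_eq0.
  by rewrite /side form_affine fx fy subrr mulr0 addr0.
apply/esym/side_eq_neq0 => //; rewrite form_affine.
have [fx|/esym/(side_eq_neq0 _ fy) fyx] := hx.
  by rewrite fx add0r subr0 mulrC -mulrA mulr_gt0// -expr2 exprn_even_gt0.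
have fyy : 0 < form H y * form H y by rewrite -expr2 exprn_even_gt0.
nra.
Qed.

(** A nonzero sign at [y] persists in a neighbourhood, and this meets the stratum of [x].
    Conversely, points just off [y] on the segment to [x] lie in the stratum of [x]. *)
Lemma face_atP x y : face_at x y <-> specializes x y.
Proof.
split=> [cy H AH|sp].
  have [fy|fy] := eqVneq (form H y) 0; first by left.
  right; have opn : open_nbhs y [set z | 0 < form H y * form H z].
    split; last by rewrite /= -expr2 exprn_even_gt0.
    have cont : continuous (fun z => form H y * form H z).
      move=> z; apply: (@cvgMl_tmp _ _ (nbhs z)); exact: affine_form_continuous.
    by apply: (@open_comp _ _ _ [set r : R | 0 < r]) => [z _|]; [exact: cont|exact: open_gt].
  have [z [/same_stratumE/(_ H AH) -> /=]] := cy _ (open_nbhs_nbhs opn).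
  by move/side_eq_neq0 => /(_ fy).
move=> B nB.
have : \forall t \near (0 : R), B (toward y x t).
  by apply: toward_continuous; rewrite toward0.
move=> /nbhs_ballP[r /= r0 rB].
have r20 : 0 < Num.min (r / 2) 1 by rewrite lt_min ltr01 andbT divr_gt0.
exists (toward y x (Num.min (r / 2) 1)); split.
  apply/same_stratumE => H AH; apply/esym/side_toward; last exact: sp.
  by rewrite r20 ge_min lexx orbT.
apply: rB; rewrite /ball /= sub0r normrN gtr0_norm//.
by rewrite gt_min; apply/orP; left; lra.
Qed.

Lemma specializes_refl x : specializes x x.
Proof. by move=> H _; right. Qed.

Lemma specializes_trans x y z :
  specializes x y -> specializes y z -> specializes x z.
Proof.
move=> xy yz H AH; have [|e] := yz H AH; first by left.
have [/side_eq0|] := xy H AH; last by rewrite e; right.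
by rewrite -e => /side_eq0; left.
Qed.

Lemma face_at_sub x y : face_at y `<=` face_at x <-> specializes x y.
Proof.
split=> [h|xy z /face_atP yz]; last exact/face_atP/(specializes_trans xy).
by apply/face_atP/h/face_atP; exact: specializes_refl.
Qed.

Lemma face_at_eq x y : face_at x = face_at y <-> same_sides x y.
Proof.
split=> [e H AH|h].
  have /face_at_sub/(_ H AH) xy : face_at y `<=` face_at x by rewrite e.
  have /face_at_sub/(_ H AH) yx : face_at x `<=` face_at y by rewrite e.
  case: xy => [/side_eq0 fy|//]; case: yx => [/side_eq0 -> //|->//].
by apply/seteqP; split; apply/face_at_sub => H AH; right; rewrite h.
Qed.

Lemma same_sides_specializes x y : same_sides x y <-> specializes x y /\ specializes y x.
Proof.
split=> [h|[xy yx]]; first by split=> H AH; right; rewrite h.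
by apply/face_at_eq/seteqP; split; exact/face_at_sub.
Qed.

Lemma suppP x H : supp A (face_at x) H <-> A H /\ form H x = 0.
Proof.
split=> -[AH h]; split=> //.
  by apply/(mem_hyperplane _ AH)/h/face_atP; exact: specializes_refl.
move=> y /face_atP/(_ H AH) [fy|e]; first exact/mem_hyperplane.
by apply/(mem_hyperplane _ AH)/side_eq0; rewrite e; apply/side_eq0.
Qed.

Lemma affine_span_sub_hyperplane H (U : set V) : A H -> U !=set0 -> U `<=` H ->
  affine_span U `<=` H.
Proof.
move=> AH [x Ux] UH; have [W HW] := hyperplane_affine_subspace (hyp AH) (UH x Ux).
by move=> y; apply; split=> //; exists x, W.
Qed.

(** Compactness of the parameter interval spreads local finiteness from points to segments. *)
Lemma segment_hyperplanes_finite x y (a b : R) :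
  finite_set [set H | A H /\ exists2 t, a <= t <= b & H (toward x y t)].
Proof.
have lf t : exists U, [/\ open U, U t &
    finite_set [set H | A H /\ exists2 s, U s & H (toward x y s)]].
  have [W nW finW] := hA.2 (toward x y t).
  exists ((toward x y @^-1` W)^°); split.
  - exact: open_interior.
  - exact: toward_continuous.
  - apply: sub_finite_set finW => H [AH [s Ws Hs]]; split=> //.
    by exists (toward x y s); split=> //; exact: (interior_subset Ws).
have [U HU] := choice lf.
have : @cover_compact R `[a, b] by rewrite -compact_cover; exact: segment_compact.
move=> /(_ R setT U) []; first by move=> t _; have [] := HU t.
  by move=> t _; exists t => //; have [] := HU t.
move=> S _ cov; apply: (@sub_finite_set _ _ (\bigcup_(t in [set` S])
   [set H | A H /\ exists2 s, U t s & H (toward x y s)])).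
  move=> H [AH [t tab Ht]]; have [|s sS Us] := cov t; first by rewrite /= in_itv.
  by exists s => //; split=> //; exists t.
by apply: bigcup_finite => // t _; have [] := HU t.
Qed.

(** Only finitely many hyperplanes meet the segment with parameters in [-1, 1], and each gives a
    bound; the others are never crossed. *)
Lemma small_keep_sides x y :
  small (fun t => forall H, A H -> form H x != 0 -> side H (toward x y t) = side H x).
Proof.
pose S := [set H | A H /\ exists2 t, -1 <= t <= 1 & H (toward x y t)].
have finS : finite_set S by exact: segment_hyperplanes_finite.
have keep H : H \in enum_fset (fset_set S) ->
    small (fun t => form H x != 0 -> side H (toward x y t) = side H x).
  move=> _; have [_|fx] := eqVneq (form H x) 0; first by exists 1.
  have fxx : 0 < form H x * form H x by rewrite -expr2 exprn_even_gt0.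
  apply: small_sub (small_gt0 (form H x * (form H y - form H x)) fxx) => t.
  rewrite mulrCA -mulrDr -form_affine => pos _.
  by apply/esym/side_eq_neq0.
apply: small_sub (small_and (small_le ltr01) (small_all keep)) => t [t1 tS] H AH fx.
have [HS|nHS] := pselect (S H); first by apply: tS => //; rewrite in_fset_set// inE.
have nz s : `|s| <= 1 -> form H (toward x y s) != 0.
  rewrite ler_norml => s1; apply/eqP => /(mem_hyperplane _ AH) Hs.
  by apply: nHS; split=> //; exists s.
apply: contrapT => /(side_neq_lt0 (nz t t1) fx) xt.
have := xt; rewrite mulrC => /(affine_crossing (@form_affine _ _ H))[s /andP[s0 s1]].
rewrite toward_toward => /eqP; apply/negP/nz.
by rewrite normrM (ger0_norm s0) mulr_ile1.
Qed.

Lemma face_hyperplanes_finite x : finite_set [set H | A H /\ form H x = 0].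
Proof.
apply: sub_finite_set (segment_hyperplanes_finite x x 0 0) => H [AH fx].
by split=> //; exists 0; rewrite ?lexx// toward0; apply/mem_hyperplane.
Qed.

(** If [x] lies on [H], its face spans at most [H]. If it lies on none, its stratum contains a short
    segment from [x] in every direction and spans everything. *)
Lemma chamberP x : chamber A (face_at x) <-> forall H, A H -> form H x != 0.
Proof.
split=> [[_ [u [W [eW dW]]]] H AH|h].
  apply/eqP => fx; have [_ xH] := (suppP x H).2 (conj AH fx).
  have x0 : face_at x !=set0 by exists x; apply/face_atP; exact: specializes_refl.
  have := affine_span_sub_hyperplane AH x0 xH; rewrite eW => sH.
  have [z nHz] := hyperplane_proper (hyp AH).
  apply: nHz; apply: sH; rewrite /affine_subspace /=.
  suff -> : W = fullv by rewrite memvf.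
  have dV : \dim {:V} = n by rewrite dimvf /dim /= mul1n.
  by apply/eqP; rewrite eqEdim subvf dV -(addn0 (\dim W)) dW leqnn.
split; first by exists x.
exists x, fullv; split; last by rewrite dimvf /dim /= mul1n addn0.
apply/seteqP; split=> y; rewrite /affine_subspace /= ?memvf// => _.
move=> Y [[u [W ->]] sub].
have [t t0 [keep _]] := small_pos (small_keep_sides x y).
have inW z : same_sides x z -> z - u \in W.
  by move=> xz; apply: sub; apply/face_atP => H AH; right; rewrite xz.
have x1 := inW x (fun H _ => erefl).
have x2 : toward x y t - u \in W.
  by apply: inW => H AH; rewrite keep ?h.
(* Dividing the difference of two points of the stratum by t recovers the arbitrary direction
   [y - x]. *)
have : t^-1 *: ((toward x y t - u) - (x - u)) \in W.
  by rewrite memvZ// memvB.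
rewrite opprB addrA subrK /toward [x + _]addrC addrK scalerA mulVf ?gt_eqF// scale1r.
by move=> yx; rewrite /affine_subspace /= -[y](subrK x) -addrA; apply: memvD.
Qed.

Lemma chamber_at C : chamber A C -> exists2 c, C = face_at c & forall H, A H -> form H c != 0.
Proof. by move=> /[dup] [[[c ->] _]] /chamberP; exists c. Qed.

(** [separates] admits any equation of [H] while [side] uses the chosen one; [same_zeros_side]
    reconciles them. *)
Lemma sepP c d H : (forall H, A H -> form H c != 0) -> (forall H, A H -> form H d != 0) ->
  sep A (face_at c) (face_at d) H <-> A H /\ side H c <> side H d.
Proof.
move=> hc hd; split=> -[AH].
  move=> [a [b [a0 Hab cneg dpos]]]; split=> //; apply/side_neq_lt0; rewrite ?hc ?hd//.
  have z0 z : affine_form a b z = 0 <-> form H z = 0 by rewrite -mem_hyperplane// Hab.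
  have nz z : form H z != 0 -> affine_form a b z != 0.
    by move=> fz; apply/eqP => /z0 /eqP; apply/negP.
  have fc : affine_form a b c < 0.
    rewrite lt_neqAle nz ?hc//= cneg//; apply/face_atP; exact: specializes_refl.
  have fd : 0 < affine_form a b d.
    rewrite lt_neqAle eq_sym nz ?hd//= dpos//; apply/face_atP; exact: specializes_refl.
  rewrite ltNge le_eqVlt eq_sym mulf_eq0 (negPf (hc _ AH)) (negPf (hd _ AH)) /=.
  apply/negP => /(same_zeros_side (@form_affine _ _ H) (@affine_form_affine _ _ a b)).
  by move=> /(_ (fun z => iff_sym (z0 z))); nra.
move=> /side_neq_lt0; rewrite hc// hd// => /(_ erefl erefl) cd; split=> //.
have [a [b [a0 Hab fE]]] := formP (hyp AH).
have half z y : face_at z y -> 0 <= form H z * form H y.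
  move=> /face_atP/(_ H AH) [->|e]; first by rewrite mulr0.
  have [->|fz] := eqVneq (form H z) 0; first by rewrite mul0r.
  by apply/ltW/side_eq_neq0.
have [cn|cp|c0] := ltgtP (form H c) 0; last by move: (hc _ AH); rewrite c0 eqxx.
  have dp : 0 < form H d by move: cd; rewrite nmulr_rlt0.
  exists a, b; rewrite -fE; split=> // z /half.
    by rewrite nmulr_rge0.
  by rewrite pmulr_rge0.
have dn : form H d < 0 by move: cd; rewrite pmulr_rlt0.
(* [separates] wants its first chamber on the nonpositive side, so the equation is negated here. *)
have oppE z : affine_form (- a) (- b) z = - form H z.
  by rewrite fE /affine_form mulmxN !mxE; ring.
exists (- a), (- b); split.
- by rewrite oppr_eq0.
- apply/seteqP; split=> z; rewrite /hyperplane /= oppE.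
    by move=> /(mem_hyperplane _ AH) ->; rewrite oppr0.
  by move=> /eqP; rewrite oppr_eq0 => /eqP fz; apply/mem_hyperplane.
- by move=> z /half; rewrite oppE pmulr_rge0// oppr_le0.
- by move=> z /half; rewrite oppE nmulr_rge0// oppr_ge0.
Qed.

(** The sign vector of C.F, with [c] inside C and [z] inside F: the composition of covectors of
    oriented matroid theory. *)
Definition pulled c z d : Prop :=
  forall H, A H -> side H d = if form H z == 0 then side H c else side H z.

Definition pull c z : V := xget 0 [set d | pulled c z d].

(** Just off [z] on the segment to [c], nonzero signs of [z] persist and zero signs become those of
    [c]. *)
Lemma pullP c z : pulled c z (pull c z).
Proof.
apply: (@xgetPex _ 0 [set d | pulled c z d]).
have [t t0 [[keep t1] _]] := small_pos (small_and (small_keep_sides z c) (small_le ltr01)).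
exists (toward z c t) => H AH; have [fz|fz] := eqVneq (form H z) 0.
  by apply: side_toward; [rewrite t0 -(gtr0_norm t0)|left].
exact: keep.
Qed.

Lemma pull_chamber c z : (forall H, A H -> form H c != 0) ->
  forall H, A H -> form H (pull c z) != 0.
Proof.
move=> hc H AH; apply/eqP => /side_eq0; rewrite (pullP c z AH).
case: (eqVneq (form H z) 0) => [_|nz] /side_eq0; first exact/eqP/hc.
exact/eqP.
Qed.

Lemma pull_specializes c z : specializes (pull c z) z.
Proof.
by move=> H AH; rewrite (pullP c z AH); case: eqP => [|_]; [left|right].
Qed.

(** All signs of C.F are forced: off the support of F because F is a face of it, on the support
    because no such hyperplane separates it from C. *)
Lemma chamber_dotE c z : (forall H, A H -> form H c != 0) ->
  chamber_dot A (face_at c) (face_at z) = face_at (pull c z).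
Proof.
move=> hc; have hp := pull_chamber z hc; apply: get_unique.
  split; [exact/chamberP|exact/face_at_sub/pull_specializes|].
  apply/seteqP; split=> // H [/suppP[AH fz] /sepP].
  by move=> /(_ hc hp)[_]; rewrite (pullP c z AH) fz eqxx.
move=> D [/chamber_at[d -> hd] /face_at_sub sub sup]; apply/face_at_eq => H AH.
rewrite (pullP c z AH); case: eqP => [fz|nz].
  apply: contrapT => ne; suff : set0 H by [].
  rewrite -sup; split; first exact/suppP.
  by apply/(sepP H hc hd); split=> // e; apply: ne.
by case: (sub H AH).
Qed.

Lemma form_eq0_side H x y : side H x = side H y -> (form H x == 0) = (form H y == 0).
Proof.
by move=> e; apply/eqP/eqP => /side_eq0 f0; apply/side_eq0; rewrite -f0 e.
Qed.

(** The cell <C.F, F>, where F need not be a face of C. *)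
Definition cell_at c z : cell R n := (face_at (pull c z), face_at z).

Lemma cell_at_eq c z w : cell_at c z = cell_at c w <-> same_sides z w.
Proof.
split=> [[_ /face_at_eq]|zw]; first by [].
rewrite /cell_at; congr pair; apply/face_at_eq; last exact: zw.
move=> H AH; rewrite (pullP c z AH) (pullP c w AH) (zw H AH).
by rewrite (form_eq0_side (zw H AH)).
Qed.

Lemma pull_face c z : specializes c z -> face_at (pull c z) = face_at c.
Proof.
move=> cz; apply/face_at_eq => H AH; rewrite (pullP c z AH).
by case: eqP => // fz; case: (cz H AH).
Qed.

Lemma SalP p : Sal A p <-> exists2 c, (forall H, A H -> form H c != 0) &
  exists2 z, specializes c z & p = cell_at c z.
Proof.
case: p => C F; split.
  move=> [/= /chamber_at[c -> hc] [[z ->]] /face_at_sub cz].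
  by exists c => //; exists z => //; rewrite /cell_at pull_face.
move=> [c hc [z cz [-> ->]]]; split=> /=.
  exact/chamberP/pull_chamber.
by split; [exists z|exact/face_at_sub/pull_specializes].
Qed.

Lemma S_cellsP c p : (forall H, A H -> form H c != 0) ->
  S_cells A (face_at c) p <-> exists z, p = cell_at c z.
Proof.
move=> hc; split.
  move=> [/SalP[d _ [z _ ->]] /=]; rewrite chamber_dotE// => e.
  by exists z; rewrite /cell_at e.
move=> [z ->]; split; last by rewrite /= chamber_dotE.
apply/SalP; exists (pull c z); first exact: pull_chamber.
exists z; first exact: pull_specializes.
by rewrite /cell_at (pull_face (pull_specializes c z)).
Qed.

(** Membership in S(D) means C.F = D.F, and these two chambers can differ only at hyperplanes
    containing F. *)
Lemma S_cells_cell_at c d z : (forall H, A H -> form H c != 0) ->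
  (forall H, A H -> form H d != 0) ->
  S_cells A (face_at d) (cell_at c z) <->
  forall H, A H -> form H z = 0 -> side H c = side H d.
Proof.
move=> hc hd; split.
  move=> /(S_cellsP _ hd)[w [/face_at_eq e /face_at_eq zw]] H AH fz.
  have fw : form H w = 0 by apply/side_eq0; rewrite -zw//; apply/side_eq0.
  by have := e H AH; rewrite (pullP c z AH) (pullP d w AH) fz fw eqxx.
move=> h; apply/S_cellsP => //; exists z; congr pair; apply/face_at_eq => H AH.
rewrite (pullP c z AH) (pullP d z AH); case: eqP => // fz.
exact: h.
Qed.

(** If F contains G then (C.G).F = C.F. So the cells below <C.G, G> are again of the form <C.F, F>,
    and the order on S(C) is that of the faces. *)
Lemma sal_lt_cell_at c w p : (forall H, A H -> form H c != 0) ->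
  Sal A p -> sal_lt A p (cell_at c w) <->
  exists z, [/\ p = cell_at c z, specializes z w & ~ specializes w z].
Proof.
move=> hc Sp; have hw := pull_chamber w hc.
have pull_pull z : specializes z w -> face_at (pull (pull c w) z) = face_at (pull c z).
  move=> zw; apply/face_at_eq => H AH; rewrite (pullP _ _ AH) (pullP c z AH).
  case: eqP => // fz; rewrite (pullP c w AH).
  suff -> : form H w = 0 by rewrite eqxx.
  by case: (zw H AH) => // e; apply/side_eq0; rewrite e; apply/side_eq0.
split.
  have /SalP[d _ [z _ ->]] := Sp.
  move=> [[/= /face_at_sub zw nwz]]; rewrite /= chamber_dotE// pull_pull// => e.
  by exists z; split; [rewrite /cell_at e|exact: zw|move=> /face_at_sub].
move=> [z [-> zw nwz]]; split=> /=; last by rewrite chamber_dotE// pull_pull.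
by split; [exact/face_at_sub|move=> /face_at_sub].
Qed.

Lemma sal_lt_irr p : ~ sal_lt A p p.
Proof. by move=> [[_ n']]; case: n'. Qed.

Lemma S_cells_down c p q : (forall H, A H -> form H c != 0) ->
  S_cells A (face_at c) q -> Sal A p -> sal_lt A p q -> S_cells A (face_at c) p.
Proof.
move=> hc /(S_cellsP _ hc)[w ->] Sp /(sal_lt_cell_at _ hc Sp)[z [-> _ _]].
by apply/S_cellsP => //; exists z.
Qed.

(** A face containing that of [w] has the signs of [w] off the hyperplanes through [w]. There are
    finitely many of these, and [S] and [T] record its zero and positive signs at them. *)
Lemma Sal_lower_finite q : Sal A q -> finite_set [set p | Sal A p /\ sal_lt A p q].
Proof.
move=> /SalP[c hc [w _ ->]].
pose S z : set (set V) := [set H | [/\ A H, form H w = 0 & form H z = 0]].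
pose T z : set (set V) := [set H | [/\ A H, form H w = 0 & 0 < form H z]].
pose X := [set H | A H /\ form H w = 0].
have finX : finite_set X by exact: face_hyperplanes_finite.
have finS z : finite_set (S z) by apply: sub_finite_set finX => H [].
have finT z : finite_set (T z) by apply: sub_finite_set finX => H [].
pose pt p := xget 0 [set z | p = cell_at c z /\ specializes z w].
have ptP p : Sal A p /\ sal_lt A p (cell_at c w) -> p = cell_at c (pt p) /\ specializes (pt p) w.
  move=> [Sp /(sal_lt_cell_at _ hc Sp)[z [e zw _]]].
  by apply: (@xgetPex _ 0 [set z | p = cell_at c z /\ specializes z w]); exists z.
apply: (@finite_by_subset_pairs _ _ _ (fun p => fset_set (S (pt p)))
   (fun p => fset_set (T (pt p))) (fset_set X)).
  move=> p _; split; apply/fsubsetP => H; rewrite !in_fset_set ?inE//;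
    by move=> [].
move=> p1 p2 /ptP[e1 zw] /ptP[e2 uw] /(fset_set_inj (finS _) (finS _)) eS.
move=> /(fset_set_inj (finT _) (finT _)) eT.
rewrite e1 e2; apply/cell_at_eq => H AH.
have [fw|fw] := eqVneq (form H w) 0; last first.
  case: (zw H AH) => [e|<-]; first by rewrite e eqxx in fw.
  by case: (uw H AH) => [e|<-//]; first by rewrite e eqxx in fw.
have S_z : S (pt p1) H <-> S (pt p2) H by rewrite eS.
have T_z : T (pt p1) H <-> T (pt p2) H by rewrite eT.
rewrite /side; have [u|u|u] := ltgtP (form H (pt p2)) 0.
- rewrite (ltr0_sg u); apply: ltr0_sg; rewrite ltNge le_eqVlt; apply/negP => /orP[/eqP/esym e|e].
    by have [_ _ e'] := S_z.1 (And3 AH fw e); rewrite e' ltxx in u.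
  by have [_ _ e'] := T_z.1 (And3 AH fw e); move: (lt_trans e' u); rewrite ltxx.
- by have [_ _ e'] := T_z.2 (And3 AH fw u); rewrite !gtr0_sg.
- by have [_ _ ->] := S_z.2 (And3 AH fw u); rewrite u.
Qed.

(** A cell avoids every earlier S(D) iff some hyperplane through [z] separates C from each such D,
    that is, iff the smallest flat X through [z] is in J(C). By validity this says that X is
    contained in |F_C|. *)
Lemma N_cellsP prec c e p : (forall H, A H -> form H c != 0) ->
  generating_face A prec (face_at c) (face_at e) ->
  N_cells A prec (face_at c) p <-> exists2 z, p = cell_at c z &
    forall H, A H -> form H e = 0 -> form H z = 0.
Proof.
move=> hc [_ [[B BA eB] _] eJ].
suff key z : N_cells A prec (face_at c) (cell_at c z) <->
    forall H, A H -> form H e = 0 -> form H z = 0.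
  split=> [/[dup] [[/(S_cellsP _ hc)[z ->] _]] /key h|[z -> /key//]].
  by exists z.
pose X := \bigcap_(H in supp A (face_at z)) H.
have Xz : X z by move=> H /suppP[AH fz]; apply/mem_hyperplane.
have suppX H : supp A X H <-> A H /\ form H z = 0.
  split=> [[AH XH]|[AH fz]]; split=> //; first by apply/mem_hyperplane => //; exact: XH.
  by move=> y; apply; exact/suppP.
have flatX : flat A X.
  by split; [exists (supp A (face_at z)) => // H []|exists z].
have selfe y : face_at y y by apply/face_atP; exact: specializes_refl.
have NX : N_cells A prec (face_at c) (cell_at c z) <-> J_ideal A prec (face_at c) X.
  split.
    move=> [_ hN]; split=> // D chD DC; have [d eD hd] := chamber_at chD; subst D.
    have := hN _ chD DC; rewrite S_cells_cell_at// => nh.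
    apply: contrapT => ne; apply: nh => H AH fz; apply: contrapT => ns.
    by apply: ne; exists H; split; [exact/suppX|apply/sepP].
  move=> [_ hJ]; split; first by apply/S_cellsP => //; exists z.
  move=> D chD DC; have [d eD hd] := chamber_at chD; subst D.
  rewrite S_cells_cell_at// => h.
  have [H [/suppX[AH fz] /sepP]] := hJ _ chD DC.
  by move=> /(_ hc hd)[_]; apply; exact: h.
rewrite NX eJ; split.
  move=> [_ Xsub] H AH fe; apply/mem_hyperplane => //.
  have [_ eH] := (suppP e H).2 (conj AH fe).
  by apply: (affine_span_sub_hyperplane AH _ eH); [exists e|exact: Xsub].
(* |F_C| is an intersection of hyperplanes of [A]; all of them contain [e], hence [z], hence X. *)
move=> h; split=> // y Xy; rewrite eB => H BH.
have AH := BA _ BH.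
apply: Xy; apply/suppP; split=> //; apply: h => //; apply/mem_hyperplane => //.
have : affine_span (face_at e) e by move=> Y [_]; apply.
by rewrite eB; apply.
Qed.

(** * The matching on N(C) *)

(** Hyperplanes through [z] but not through [e] are included. Each member meets the segment from [e]
    to [z], whence finiteness. *)
Definition opposite e z : set (set V) :=
  [set H | [/\ A H, form H e != 0 & side H z <> side H e]].

Lemma opposite_finite e z : finite_set (opposite e z).
Proof.
apply: sub_finite_set (segment_hyperplanes_finite e z 0 1) => H [AH fe ne].
split=> //; have [fz|fz] := eqVneq (form H z) 0.
  by exists 1; rewrite ?ler01 ?lexx// toward1; apply/mem_hyperplane.
have /(affine_crossing (@form_affine _ _ H))[t t01 ft] : form H e * form H z < 0.
  by apply/(side_neq_lt0 fe fz) => e'; apply: ne.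
by exists t => //; apply/mem_hyperplane.
Qed.

(** The equation of [H] rescaled to be negative at [e] when [e] is off [H]. *)
Definition away e H z : R := - form H e * form H z.

Lemma away_affine e H : affine (away e H).
Proof. by move=> x y t; rewrite /away form_affine; ring. Qed.

Lemma away_ge0 e H z : form H e != 0 -> 0 <= away e H z <-> side H z <> side H e.
Proof.
move=> fe; have := side_eq_neq0 z fe; rewrite /away mulNr oppr_ge0 leNgt => E.
split=> [/negP h e'|h]; first by apply: h; apply/E.
by apply/negP => /E e'; apply: h.
Qed.

Lemma away_eq0 e H z : form H e != 0 -> away e H z = 0 <-> form H z = 0.
Proof.
move=> fe; rewrite /away; split=> [/eqP|->]; last by rewrite mulr0.
by rewrite mulf_eq0 oppr_eq0 (negPf fe) => /eqP.
Qed.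

(** The convex set carrying the functions [away e H] for H in W. It contains [e], and signs at
    hyperplanes off [e] and outside W are prescribed, so only W can be opposite to [e]. *)
Definition slice e (W : {fset set V}) : set V :=
  [set y | (forall H, A H -> form H e = 0 -> form H y = 0) /\
    forall H, A H -> form H e != 0 -> H \notin W -> side H y = side H e].

Lemma slice_relopen_convex e W : relopen_convex (slice e W).
Proof.
split=> [x y t [x0 xs] [y0 ys] /andP[t0 t1]|x y [x0 xs] [y0 ys]].
  split=> H AH fe; first by rewrite form_affine x0// y0// subrr mulr0 addr0.
  move=> HW; have [->|tn] := eqVneq t 0; first by rewrite toward0 xs.
  rewrite side_toward ?ys//; first by rewrite lt_neqAle eq_sym tn t0.
  by right; rewrite xs.
apply: small_sub (small_keep_sides x y) => t keep; split=> H AH fe.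
  by rewrite form_affine x0// y0// subrr mulr0 addr0.
move=> HW; rewrite keep//; first exact: xs.
by apply/eqP => /side_eq0; rewrite xs// => /side_eq0; exact/eqP.
Qed.

Definition slice_part e (W : {fset set V}) : set V :=
  nonneg_part (away e) (enum_fset W) (slice e W).

(** [perfectly_paired] on a slice, with partners required only for nonempty W: the empty set gives
    the critical cell. *)
Definition pairing_height e (W : {fset set V}) (h : V -> nat) : Prop :=
  let Z := zeros_le (away e) (enum_fset W) in [/\
    forall y y', slice_part e W y -> slice_part e W y' -> Z y y' -> (h y <= h y')%N,
    W != fset0 -> forall y, slice_part e W y -> exists2 y', slice_part e W y' &
      [/\ h y' = h y, ~ (Z y y' /\ Z y' y) & Z y y' \/ Z y' y] &
    forall y1 y2 y3, slice_part e W y1 -> slice_part e W y2 ->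
      slice_part e W y3 -> h y1 = h y2 -> h y1 = h y3 ->
      [\/ Z y1 y2 /\ Z y2 y1, Z y1 y3 /\ Z y3 y1 | Z y2 y3 /\ Z y3 y2]].

Lemma pairing_height_exists e (W : {fset set V}) :
  (forall H, H \in W -> A H /\ form H e != 0) -> exists h, pairing_height e W h.
Proof.
move=> hW; have [->|W0] := eqVneq W fset0.
  by exists (fun=> 0%N); split=> // *; apply: Or31; split.
have /perfectly_paired_visible : forall H, affine (away e H) by exact: away_affine.
move=> /(_ (enum_fset W) (slice e W) e (slice_relopen_convex e W)) [].
- by split=> // H AH _.
- by apply: contra W0 => /eqP eW; apply/eqP/fsetP => H; rewrite -[H \in W]/(H \in enum_fset W) eW.
- move=> H /hW[_ fe]; rewrite /away mulNr oppr_lt0 -expr2.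
  by rewrite exprn_even_gt0.
by move=> h [N [_ *]]; exists h; split.
Qed.

Lemma slice_partP e z : (forall H, A H -> form H e = 0 -> form H z = 0) ->
  slice_part e (fset_set (opposite e z)) z.
Proof.
move=> z0; have fin := opposite_finite e z; split.
  split=> // H AH fe; rewrite in_fset_set// => /negP nH.
  by apply: contrapT => ns; apply: nH; apply/mem_set.
by move=> H; rewrite -[_ \in _]/(H \in fset_set _) in_fset_set// => /set_mem[_ fe ns]; apply/away_ge0.
Qed.

Lemma slice_part_opposite e z y : slice_part e (fset_set (opposite e z)) y ->
  opposite e y = opposite e z.
Proof.
have fin := opposite_finite e z; move=> [[y0 ys] yW].
have inW H : H \in fset_set (opposite e z) <-> opposite e z H.
  by rewrite in_fset_set// inE.
apply/seteqP; split=> H.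
  move=> [AH fe ns]; apply/inW; apply/negPn/negP => HW; apply: ns.
  exact: ys.
move=> oH; have [AH fe _] := oH; split=> //; apply/away_ge0 => //.
by apply: yW; exact/inW.
Qed.

(** At hyperplanes through [e] the sign of [w] is 0; at the others outside the common set both
    points have the sign of [e]; inside it each sign is 0 or opposite to that of [e]. Only the zeros
    remain to be compared. *)
Lemma specializes_opposite e z w :
  (forall H, A H -> form H e = 0 -> form H w = 0) ->
  opposite e z = opposite e w ->
  specializes z w <-> zeros_le (away e) (enum_fset (fset_set (opposite e z))) z w.
Proof.
move=> w0 ezw; have fin := opposite_finite e z.
have inW H : H \in enum_fset (fset_set (opposite e z)) <-> opposite e z H.
  by rewrite -[_ \in _]/(H \in fset_set _) in_fset_set// inE.
split=> [sp H /inW[AH fe _] /(away_eq0 _ fe) fz|h H AH].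
  apply/away_eq0 => //; case: (sp H AH) => // e'.
  by apply/side_eq0; rewrite e'; apply/side_eq0.
have [fe|fe] := eqVneq (form H e) 0; first by left; exact: w0.
have [oz|noz] := pselect (opposite e z H); last first.
  have now : ~ opposite e w H by rewrite -ezw.
  right; have [-> ->] : side H z = side H e /\ side H w = side H e; last by [].
  by split; apply: contrapT => ns; [apply: noz|apply: now].
have ow : opposite e w H by rewrite -ezw.
have [fw|fw] := eqVneq (form H w) 0; [by left|right].
have fz : form H z != 0.
  apply: contra fw => /eqP fz; apply/eqP/(away_eq0 _ fe)/h; [exact/inW|exact/away_eq0].
have [_ _ /nesym/(side_neq_lt0 fe fz) ez] := oz.
have [_ _ /nesym/(side_neq_lt0 fe fw) ew] := ow.
apply/side_eq_neq0 => //.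
have [f|f|f] := ltgtP (form H e) 0; last by rewrite f eqxx in fe.
  by apply: mulr_gt0; [move: ew|move: ez]; rewrite nmulr_rlt0.
by rewrite -mulrNN; apply: mulr_gt0; [move: ew|move: ez]; rewrite pmulr_rlt0// oppr_gt0.
Qed.

Lemma opposite_mono e z w : specializes z w -> opposite e z `<=` opposite e w.
Proof.
move=> zw H [AH fe ns]; split=> //; case: (zw H AH) => [fw|-> //].
move=> e'; move/eqP: fe; apply; apply/side_eq0; rewrite -e'; exact/side_eq0.
Qed.

Lemma opposite_same e z w : same_sides z w -> opposite e z = opposite e w.
Proof.
by move=> /same_sides_specializes[*]; apply/seteqP; split; exact: opposite_mono.
Qed.

(** [fibre_matching_proper] is applied with the opposite set as grading, refined by a height chosen
    for each such set. *)
Lemma N_cells_matching prec c e : (forall H, A H -> form H c != 0) ->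
  generating_face A prec (face_at c) (face_at e) ->
  exists M, proper_acyclic_matching (N_cells A prec (face_at c)) (sal_lt A) M /\
    critical (N_cells A prec (face_at c)) M = [set (face_at c, face_at e)].
Proof.
move=> hc gen; set N := N_cells A prec (face_at c).
have NP p : N p <-> exists2 z, p = cell_at c z &
    forall H, A H -> form H e = 0 -> form H z = 0 by exact: N_cellsP.
pose in_flat z := forall H, A H -> form H e = 0 -> form H z = 0.
have fin z := opposite_finite e z.
pose w z := fset_set (opposite e z).
have wE z u : w z = w u -> opposite e z = opposite e u by exact: fset_set_inj.
(* The condition on W sits under the existential, so that [choice] yields a height for every finite
   set. *)
have ex_height (W : {fset set V}) : exists h,
    (forall H, H \in W -> A H /\ form H e != 0) -> pairing_height e W h.
  have [hW|nW] := pselect (forall H, H \in W -> A H /\ form H e != 0).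
    by have [h hh] := pairing_height_exists hW; exists h.
  by exists (fun=> 0%N).
have [h hP] := choice ex_height.
have wW z H : H \in w z -> A H /\ form H e != 0.
  by rewrite in_fset_set// => /set_mem[].
have hmono z u : in_flat z -> in_flat u -> w z = w u -> specializes z u ->
    (h (w z) z <= h (w u) u)%N.
  move=> z0 u0 ezu zu; have [mono _ _] := hP _ (wW z).
  rewrite -ezu; apply: mono; first exact: slice_partP.
    by rewrite [w z]ezu; exact: slice_partP.
  exact/(specializes_opposite u0 (wE _ _ ezu)).
have hsame z u : in_flat z -> in_flat u -> same_sides z u ->
    w z = w u /\ h (w z) z = h (w u) u.
  move=> z0 u0 /[dup] zu /same_sides_specializes[zu1 uz1].
  have ew : w z = w u by rewrite /w (opposite_same e zu).
  by split=> //; apply/eqP; rewrite eqn_leq !hmono.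
pose pt p := xget 0 [set z | p = cell_at c z /\ in_flat z].
have ptP p : N p -> p = cell_at c (pt p) /\ in_flat (pt p).
  move=> /NP[z e1 e2]; apply: (@xgetPex _ 0 [set z | p = cell_at c z /\ in_flat z]).
  by exists z.
have ltP p q : N p -> N q ->
    sal_lt A p q <-> specializes (pt p) (pt q) /\ ~ specializes (pt q) (pt p).
  move=> Np Nq; have [ep _] := ptP p Np; have [eq _] := ptP q Nq.
  have Sp : Sal A p by case: Np => -[].
  rewrite {1}eq; split.
    move=> /(sal_lt_cell_at _ hc Sp)[z [ez zq nqz]].
    have : same_sides (pt p) z by apply/(cell_at_eq c); rewrite -ep.
    move=> /same_sides_specializes[pz zp]; split; first exact: specializes_trans pz zq.
    by move=> qp; apply: nqz; exact: specializes_trans qp pz.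
  by move=> [pq qp]; apply/sal_lt_cell_at => //; exists (pt p).
have eq_spec p q : N p -> N q -> specializes (pt p) (pt q) -> specializes (pt q) (pt p) -> p = q.
  move=> Np Nq pq qp; have [ep _] := ptP p Np; have [eq _] := ptP q Nq.
  by rewrite ep eq; apply/cell_at_eq/same_sides_specializes.
pose W p := w (pt p); pose hh p := h (W p) (pt p).
have mono p q : N p -> N q -> sal_lt A q p ->
    fsubset (W q) (W p) /\ (W q = W p -> (hh q <= hh p)%N).
  move=> Np Nq /(ltP _ _ Nq Np)[qp _]; split.
    by rewrite /W /w -fset_set_sub//; exact: opposite_mono.
  by move=> eW; apply: hmono => //; [case: (ptP q Nq)|case: (ptP p Np)].
have slice_pt p q : N q -> W p = W q -> slice_part e (W p) (pt q).
  by move=> /ptP[_ q0] ->; exact: slice_partP.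
have zeros_spec p q : N p -> N q -> W p = W q ->
    zeros_le (away e) (enum_fset (W p)) (pt p) (pt q) <-> specializes (pt p) (pt q).
  move=> Np Nq eW; apply: iff_sym; apply: specializes_opposite; last exact: wE.
  by case: (ptP q Nq).
exists (fibre_matching (sal_lt A) N W hh); split.
  apply: fibre_matching_proper => //.
  - exact: sal_lt_irr.
  - move=> p q r Np Nq Nr /(ltP _ _ Np Nq)[pq nqp] /(ltP _ _ Nq Nr)[qr nrq].
    apply/(ltP _ _ Np Nr); split; first exact: specializes_trans pq qr.
    by move=> rp; apply: nqp; exact: specializes_trans qr rp.
  (* A cell of N(C) is determined by its opposite set and the hyperplanes of that set on which it
     has sign 0. *)
  - move=> X; pose T p := [set H | opposite e (pt p) H /\ form H (pt p) = 0].
    have finT p : finite_set (T p) by apply: sub_finite_set (fin (pt p)) => H [].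
    apply: (@finite_by_subset_pairs _ _ _ W (fun p => fset_set (T p)) X).
      move=> p [Np WX]; split=> //; apply: fsubset_trans WX.
      by rewrite /W /w -fset_set_sub// => H [].
    move=> p q [Np _] [Nq _] eW /(fset_set_inj (finT _) (finT _)) eT.
    have half a b : N a -> N b -> W a = W b -> T a = T b -> specializes (pt a) (pt b).
      move=> Na Nb eab Tab; apply/zeros_spec => // H.
      rewrite -[_ \in _]/(H \in w _) in_fset_set// inE => oH.
      have [AH fe _] := oH.
      move=> /(away_eq0 _ fe) fa; apply/away_eq0 => //.
      by have : T a H by []; rewrite Tab => -[].
    by apply: eq_spec => //; apply: half.
  - move=> p q r Np Nq Nr epq epr hpq hpr.
    have [_ _ fib] := hP _ (wW (pt p)).
    have := fib (pt p) (pt q) (pt r) (slice_pt p p Np erefl) (slice_pt p q Nq epq) (slice_pt p r Nr epr).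
    rewrite -[w _]/(W p) {2}epq {3}epr => /(_ hpq hpr).
    have eq_zeros a b : N a -> N b -> W p = W a -> W p = W b ->
        zeros_le (away e) (enum_fset (W p)) (pt a) (pt b) ->
        zeros_le (away e) (enum_fset (W p)) (pt b) (pt a) -> a = b.
      move=> Na Nb ea eb zab zba; apply: (eq_spec _ _ Na Nb).
        by apply/(zeros_spec _ _ Na Nb); rewrite -ea.
      by apply/(zeros_spec _ _ Nb Na); rewrite -eb.
    case=> -[z1 z2]; [apply: Or31|apply: Or32|apply: Or33]; exact: eq_zeros.
have e0 : in_flat e by [].
have ce : specializes c e by case: gen => -[_ /face_at_sub].
have cell_e : cell_at c e = (face_at c, face_at e) by rewrite /cell_at pull_face.
have We : w e = fset0.
  apply/fsetP => H; rewrite in_fset_set// inE; apply/negP => /set_mem[_ _].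
  exact.
(* With nothing opposite, the signs are those of [e] off the support of F_C and vanish on it. *)
have W0e p : N p -> W p = fset0 -> p = cell_at c e.
  move=> Np W0; have [ep p0] := ptP p Np; rewrite ep; apply/cell_at_eq.
  move=> H AH; have [fe|fe] := eqVneq (form H e) 0.
    by rewrite (side_eq0 H e).2//; apply/side_eq0; exact: p0.
  apply: contrapT => ns; suff : H \in W p by rewrite W0.
  by rewrite in_fset_set//; apply/mem_set.
have Ne : N (cell_at c e) by apply/NP; exists e.
have We0 : W (cell_at c e) = fset0.
  have [ee p0] := ptP _ Ne; rewrite -We; apply: (hsame _ _ p0 e0 _).1.
  by apply/(cell_at_eq c); rewrite -ee.
rewrite -cell_e; apply/seteqP; split=> p; last first.
  (* An edge at the cell of [e] would have both ends in the fibre of the empty set, hence equal. *)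
  move=> ->; split=> // -[a b] [/= Na Nb ab eW _] [] /= E; subst.
    by apply: (@sal_lt_irr (cell_at c e)); rewrite -{1}(W0e b Nb)// -eW.
  by apply: (@sal_lt_irr (cell_at c e)); rewrite -{2}(W0e a Na)// eW.
move=> [Np cr]; apply: contrapT => pe.
have W0 : W p != fset0 by apply/eqP => /(W0e p Np).
have [_ ex _] := hP _ (wW (pt p)).
(* The partner comes as a point [y], while its cell [q] is represented by [pt q], possibly another
   point of the same stratum; the relations are carried over. *)
have [y sy [hy nz cmp]] := ex W0 (pt p) (slice_pt p p Np erefl).
have y0 : in_flat y by case: sy => -[].
pose q := cell_at c y.
have Nq : N q by apply/NP; exists y.
have [eq q0] := ptP q Nq.
have yq : same_sides y (pt q) by apply/(cell_at_eq c); rewrite -eq.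
have [yq1 qy1] := (same_sides_specializes _ _).1 yq.
have oy := slice_part_opposite sy.
have wy : w y = W p by rewrite /w oy.
have [ewq ehq] := hsame _ _ y0 q0 yq.
have eW : W p = W q by rewrite -wy.
have eh : hh p = hh q.
  by rewrite /hh -eW -wy ewq -[w (pt q)]ewq /= in ehq *; rewrite -ehq wy hy.
have zpy : zeros_le (away e) (enum_fset (W p)) (pt p) y <-> specializes (pt p) (pt q).
  apply: iff_trans (iff_sym (specializes_opposite y0 (esym oy))) _.
  by split=> s; apply: specializes_trans s _.
have zyp : zeros_le (away e) (enum_fset (W p)) y (pt p) <-> specializes (pt q) (pt p).
  have p0 := (ptP p Np).2.
  have E := specializes_opposite p0 oy.
  rewrite -wy; apply: iff_trans (iff_sym E) _.
  by split=> s; [apply: specializes_trans qy1 s|apply: specializes_trans yq1 s].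
have npq : ~ (specializes (pt p) (pt q) /\ specializes (pt q) (pt p)).
  by move=> [/zpy a /zyp b]; apply: nz.
case: cmp => [/zpy pq|/zyp qp].
  apply: (cr (q, p) _ (or_intror erefl)); split;
    [exact: Nq|exact: Np| |exact: esym eW|exact: esym eh].
  by apply/(ltP _ _ Np Nq); split; [exact: pq|move=> qp; apply: npq; split].
apply: (cr (p, q) _ (or_introl erefl)); split;
  [exact: Np|exact: Nq| |exact: eW|exact: eh].
by apply/(ltP _ _ Nq Np); split; [exact: qp|move=> pq; apply: npq; split].
Qed.

End Faces.

(** * The union of the matchings *)

(** The rank counts predecessors if there are finitely many chambers, and otherwise is the position
    in the enumeration. *)
Lemma chamber_order_rank (R : realType) (n : nat) (A : set (set 'rV[R]_n))
    (prec : set 'rV[R]_n -> set 'rV[R]_n -> Prop) :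
  chamber_order A prec -> exists rk : set 'rV[R]_n -> nat,
    forall C D, chamber A C -> chamber A D -> prec C D -> (rk C < rk D)%N.
Proof.
move=> [[irr tr _] inf]; have [fin|/inf[e [[_ _ sur] eP]]] := pselect (finite_set (chamber A)).
  pose below C := [set D | chamber A D /\ prec D C].
  have finb C : finite_set (below C) by apply: sub_finite_set fin => D [].
  exists (fun C => #|` fset_set (below C)|) => C D chC chD CD.
  apply: fproper_ltn_card; rewrite fproperEneq; apply/andP; split.
    apply/eqP => /(fset_set_inj (finb _) (finb _)) e.
    have : below D C by [].
    by rewrite -e => -[_]; exact: irr.
  by rewrite -fset_set_sub// => G [chG GC]; split=> //; exact: tr GC CD.
exists (fun C => xget 0%N [set i | e i = C]) => C D chC chD.
have eK F : chamber A F -> e (xget 0%N [set i | e i = F]) = F.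
  by move=> /sur[i _ ei]; apply: (@xgetPex _ 0%N [set i | e i = F]); exists i.
by rewrite -{1}(eK C chC) -{1}(eK D chD) => /eP.
Qed.

Theorem theorem4p10 (R : realType) (n : nat) (A : set (set 'rV[R]_n))
  (prec : set 'rV[R]_n -> set 'rV[R]_n -> Prop)
  (FC : set 'rV[R]_n -> set 'rV[R]_n)
  (hA : arrangement A)
  (hprec : valid_order A prec)
  (hFC : forall C, chamber A C -> generating_face A prec C (FC C)) :
  (forall C, chamber A C ->
     exists M : set (cell R n * cell R n),
       proper_acyclic_matching (N_cells A prec C) (sal_lt A) M /\
       critical (N_cells A prec C) M = [set (C, FC C)])
  /\
  (forall M : set 'rV[R]_n -> set (cell R n * cell R n),
     (forall C, chamber A C ->
        proper_acyclic_matching (N_cells A prec C) (sal_lt A) (M C) /\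
        critical (N_cells A prec C) (M C) = [set (C, FC C)]) ->
     let U := \bigcup_(C in chamber A) M C in
     proper_acyclic_matching (Sal A) (sal_lt A) U /\
     set_bij (chamber A) (critical (Sal A) U) (fun C => (C, FC C))).
Proof.
split=> [C chC|M hM U].
  have [c eC hc] := chamber_at hA chC; subst C.
  have gen := hFC _ chC; have [[[e eF] _] _ _] := gen.
  by rewrite eF in gen *; exact: N_cells_matching.
have [[[irr tr tot] _] _] := hprec.
have [rk rkP] := chamber_order_rank hprec.1.
(* The piece of a cell is found by passing to earlier chambers whose S contains it, which stops
   because the rank drops. *)
have cover p : Sal A p <-> exists2 C, chamber A C & N_cells A prec C p.
  split; last by move=> [C _ [[]]].
  move=> Sp; have [c hc [z _ ep]] := (SalP hA p).1 Sp.
  have : exists C, chamber A C /\ S_cells A C p.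
    by exists (face_at A c); split; [exact/chamberP|apply/S_cellsP => //; exists z].
  move=> [C]; have [k] := ubnP (rk C); elim: k C => // k IH C ltCk [chC SC].
  have [[D [chD SD DC]]|no] := pselect (exists D, [/\ chamber A D, S_cells A D p & prec D C]).
    apply: (IH D) => //; apply: leq_trans (rkP _ _ chD chC DC) _.
    by rewrite -ltnS.
  by exists C => //; split=> // D chD DC SD; apply: no; exists D.
have disjoint C D p : chamber A C -> chamber A D -> N_cells A prec C p ->
    N_cells A prec D p -> C = D.
  move=> chC chD [SC nC] [SD nD]; apply: contrapT => CD.
  by have [/(nD _ chC)|/(nC _ chD)] := tot C D chC chD CD.
have mono C D p q : chamber A C -> chamber A D -> N_cells A prec C p ->
    N_cells A prec D q -> sal_lt A p q -> C = D \/ (rk C < rk D)%N.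
  move=> chC chD [SC nC] [SD nD] pq; have [->|CD] := pselect (C = D); [by left|right].
  have [/rkP|DC] := tot C D chC chD CD; first exact.
  (* If D came before C, then [p] would lie in S(D), which is closed downwards, against [p] being in
     N(C). *)
  have [d eD hd] := chamber_at hA chD; subst D.
  case: (nC _ chD DC); apply: (S_cells_down hA hd SD) => //.
  by case: SC.
have proper C : chamber A C -> proper_acyclic_matching (N_cells A prec C) (sal_lt A) (M C).
  by move=> /hM[].
split; first by apply: patchwork cover disjoint mono (Sal_lower_finite hA) proper.
rewrite /U (patch_critical cover disjoint proper); split.
- by move=> C chC; exists C => //; rewrite (hM C chC).2.
- by move=> C D _ _ [].
- by move=> p [C chC]; rewrite (hM C chC).2 => ->; exists C.
Qed.
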